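(* Let $\kappa\in\mathbb{R}$ and let $\Sigma$ be a closed surface equipped with a locally $\mathrm{CAT}(\kappa)$ metric $d$. Then the Hausdorff dimension of $(\Sigma,d)$ satisfies $\dim_H(\Sigma,d)=2$. Moreover, there exists some $\delta_0>0$ such that for all $0<\delta\leq\delta_0$, $$\inf_{p\in\Sigma}H^2(B(p,\delta))>0\quad\text{and}\quad \sup_{p\in\Sigma}H^2(B(p,\delta))<\infty .$$
   Context: A closed surface is a compact connected topological $2$-manifold without boundary. A metric $d$ on $\Sigma$ (inducing the manifold topology) is locally $\mathrm{CAT}(\kappa)$ if it is a length metric and every point has a closed metric ball of positive radius around it which, with the restricted metric, is a $\mathrm{CAT}(\kappa)$ space. No smoothness of $d$ is assumed. $H^2$ denotes the $2$-dimensional Hausdorff measure of $(\Sigma,d)$, and $B(p,\delta)=\{z\in\Sigma: d(p,z)\leq\delta\}$. *)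

(* Defs.v *)
From HB Require Import structures.
From mathcomp Require Import all_boot all_order all_algebra.
From mathcomp Require Import all_classical all_reals all_analysis.

Set Implicit Arguments.
Unset Strict Implicit.
Unset Printing Implicit Defensive.

Import Order.TTheory GRing.Theory Num.Theory.
Import numFieldNormedType.Exports.

Local Open Scope classical_set_scope.
Local Open Scope ring_scope.

(** * Closed surfaces *)

Definition homeomorphism_between (X Y : topologicalType) (U : set X) (V : set Y)
    (f : X -> Y) (g : Y -> X) : Prop :=
  [/\ f @` U = V, {in U, cancel f g},
      {within U, continuous f} & {within V, continuous g}].

Definition locally_euclidean (R : realType) (n : nat) (X : topologicalType) :
    Prop :=
  forall x : X, exists (U : set X) (V : set 'rV[R]_n)
      (f : X -> 'rV[R]_n) (g : 'rV[R]_n -> X),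
    [/\ open U, U x, open V & homeomorphism_between U V f g].

Definition topological_manifold (R : realType) (n : nat) (X : topologicalType) :
    Prop :=
  [/\ hausdorff_space X, @second_countable X & locally_euclidean R n X].

(* [connected] holds of the empty set; a connected surface is nonempty. *)
Definition closed_surface (R : realType) (X : topologicalType) : Prop :=
  [/\ topological_manifold R 2 X, compact [set: X], connected [set: X]
    & [set: X] !=set0].

(** * Length metrics *)

(* The metric analogue of [variation] and [total_variation]. *)
Definition chain_length (R : realType) (X : metricType R) (a b : R)
    (c : R -> X) (s : seq R) : R :=
  \sum_(0 <= i < size s) mdist (c (nth b (a :: s) i)) (c (nth b (a :: s) i.+1)).

Definition curve_length (R : realType) (X : metricType R) (a b : R)
    (c : R -> X) : \bar R :=
  ereal_sup [set (chain_length a b c s)%:E | s in [set s | itv_partition a b s]].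

Definition is_path_between (R : realType) (X : metricType R) (x y : X)
    (c : R -> X) : Prop :=
  [/\ {within `[0, 1], continuous c}, c 0 = x & c 1 = y].

(* Nonrectifiable paths have length [+oo] and do not affect the infimum. *)
Definition length_metric (R : realType) (X : metricType R) : Prop :=
  forall x y : X,
    (mdist x y)%:E =
    ereal_inf [set curve_length 0 1 c | c in is_path_between x y].

(** * Geodesics and geodesic triangles

   These are stated for a distance function [d] on a subset [A] of a type, so
   that they apply both to subsets of a metric space with the restricted metric
   and to the model planes. *)

Definition geodesic (R : realType) (T : Type) (d : T -> T -> R) (A : set T)
    (x y : T) (c : R -> T) : Prop :=
  [/\ c 0 = x, c (d x y) = y, {in `[0, d x y], forall t : R, A (c t)}
    & {in `[0, d x y] &, forall s t : R, d (c s) (c t) = `|s - t|}].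

(* The [i]-th side joins the [i]-th vertex to the cyclically next one. *)
Definition geodesic_triangle (R : realType) (T : Type) (d : T -> T -> R)
    (A : set T) (v : 'I_3 -> T) (c : 'I_3 -> R -> T) : Prop :=
  forall i, geodesic d A (v i) (v (ordS i)) (c i).

Definition perimeter (R : realType) (T : Type) (d : T -> T -> R)
    (v : 'I_3 -> T) : R :=
  \sum_(i < 3) d (v i) (v (ordS i)).

(** * The model planes of constant curvature *)

Section model_plane.
Context {R : realType}.
Implicit Types (kappa : R) (u v : 'rV[R]_3).

Definition dot3 u v : R := \sum_(i < 3) u 0 i * v 0 i.

Definition lorentz3 u v : R := dot3 u v - 2 * (u 0 0 * v 0 0).

Definition acosh (x : R) : R := ln (x + Num.sqrt (x ^+ 2 - 1)).

(* The unit sphere, the upper sheet of the unit hyperboloid, or a copy of the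
   Euclidean plane, according to the sign of [kappa]; the curvature is adjusted
   by scaling the distance. *)
Definition model_plane kappa : set 'rV[R]_3 :=
  [set u | if 0 < kappa then dot3 u u = 1
           else if kappa < 0 then lorentz3 u u = -1 /\ 0 < u 0 0
           else u 0 0 = 0].

Definition model_dist kappa u v : R :=
  if 0 < kappa then acos (dot3 u v) / Num.sqrt kappa
  else if kappa < 0 then acosh (- lorentz3 u v) / Num.sqrt (- kappa)
  else Num.sqrt (dot3 (u - v) (u - v)).

Definition model_diameter kappa : \bar R :=
  if 0 < kappa then (pi / Num.sqrt kappa)%:E else +oo%E.

End model_plane.

(** * CAT(kappa) spaces *)

Definition comparison_triangle (R : realType) (kappa : R) (T : Type)
    (d : T -> T -> R) (v : 'I_3 -> T)
    (v' : 'I_3 -> 'rV[R]_3) (c' : 'I_3 -> R -> 'rV[R]_3) : Prop :=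
  geodesic_triangle (model_dist kappa) (model_plane kappa) v' c' /\
  forall i, model_dist kappa (v' i) (v' (ordS i)) = d (v i) (v (ordS i)).

(* Sides are parametrized by arc length, so the comparison point of [c i s] is
   [c' i s]. *)
Definition CAT_inequality (R : realType) (kappa : R) (T : Type)
    (d : T -> T -> R) (v : 'I_3 -> T) (c : 'I_3 -> R -> T) : Prop :=
  forall v' c', comparison_triangle kappa d v v' c' ->
  forall (i j : 'I_3) (s t : R),
    s \in `[0, d (v i) (v (ordS i))] -> t \in `[0, d (v j) (v (ordS j))] ->
    d (c i s) (c j t) <= model_dist kappa (c' i s) (c' j t).

(* The subset [A] with the restricted metric is a CAT(kappa) space; geodesics
   are required to lie in [A]. *)
Definition CAT_space (R : realType) (kappa : R) (X : metricType R) (A : set X) :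
    Prop :=
  (forall x y, A x -> A y -> ((mdist x y)%:E < model_diameter kappa)%E ->
     exists c, geodesic mdist A x y c) /\
  (forall v c, geodesic_triangle mdist A v c ->
     ((perimeter mdist v)%:E < 2%:E * model_diameter kappa)%E ->
     CAT_inequality kappa mdist v c).

(* Not the library's [closed_ball], which is the closure of the open ball. *)
Definition metric_ball (R : realType) (X : metricType R) (p : X) (r : R) :
    set X :=
  [set z | mdist p z <= r].

Definition locally_CAT (R : realType) (kappa : R) (X : metricType R) : Prop :=
  length_metric X /\
  forall p : X, exists2 r : R, 0 < r & CAT_space kappa (metric_ball p r).

(** * Hausdorff measure and dimension *)

Section hausdorff.
Context {R : realType} {X : metricType R}.
Implicit Types (s eps : R) (A : set X).
Local Open Scope ereal_scope.

Definition mdiam A : \bar R :=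
  ereal_sup [set (mdist z.1 z.2)%:E | z in A `*` A].

(* The empty set has gauge 0 also for [s = 0], where [0 `^ 0 = 1]. *)
Definition hausdorff_gauge s A : \bar R :=
  if A == set0 then 0 else mdiam A `^ s.

Definition hausdorff_content s eps A : \bar R :=
  ereal_inf [set \sum_(0 <= i <oo) hausdorff_gauge s (U i) | U in
    [set U : (set X)^nat |
      A `<=` \bigcup_i U i /\ forall i, mdiam (U i) <= eps%:E]].

(* Without a dimensional constant: this is [4 / pi] times the [H^2] that agrees
   with area in the Euclidean plane. *)
Definition hausdorff_measure s A : \bar R :=
  ereal_sup [set hausdorff_content s eps A | eps in [set eps | (0 < eps)%R]].

Definition hausdorff_dim A : \bar R :=
  ereal_inf [set s%:E | s in [set s | (0 <= s)%R /\ hausdorff_measure s A = 0]].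

End hausdorff.

(* Main.v *)
Require Import Defs.
From HB Require Import structures.
From mathcomp Require Import all_boot all_order all_algebra.
From mathcomp Require Import all_classical all_reals all_analysis.
From mathcomp Require Import ring lra.

Set Implicit Arguments.
Unset Strict Implicit.
Unset Printing Implicit Defensive.

Import Order.TTheory GRing.Theory Num.Theory.
Import numFieldNormedType.Exports.

Local Open Scope classical_set_scope.
Local Open Scope ring_scope.

(** The two halves of the theorem have different reasons.

    Finite area uses curvature. In the model plane, moving two points towards a
    third one by the same fraction of their distances to it brings them closer
    together, and the CAT inequality transfers this to small geodesic triangles
    of the surface ([cone_contraction]). Hence the geodesic cone with apex [p]
    over a geodesic segment is a Lipschitz image of a square. Take a small
    square around [p] in a chart, subdivide its boundary finely, replace the
    pieces by geodesic segments and form the cones from [p] over them. The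
    polygon winds once around [p], so the finitely many cones must fill a
    neighbourhood of [p]; otherwise a point left out would contradict a parity
    count in the style of Sperner's lemma ([square_fan_dense]). By compactness
    the whole surface is covered, for some constant [C], by at most [C * m ^ 2]
    balls of radius [1 / m] for each [m] ([quad_covered_surface]). This bounds
    the two-dimensional measure and annihilates those of larger dimension.

    Positive area is purely topological. Given any metric on a square, the
    distances to two adjacent sides form a Lipschitz map to the plane, and by
    the Poincare-Miranda theorem its image contains a Euclidean square whose side
    depends only on the distances between opposite sides. Covers of the metric
    square therefore have a definite sum of squared diameters
    ([besicovitch_inequality]). Applied in charts and made uniform by
    compactness ([surface_ball_gauge]), this bounds the measure of balls of a
    given radius from below; as the bound concerns arbitrary covers, it also
    excludes dimensions below two. *)

(** * A parity count for labelled grids *)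

(** The first component singles out the upper half-plane; below it, the second
    one tells the two quadrants apart. The closures of these three sectors
    meet only at the origin, so a small triangle with a vertex in each is
    close to it. *)
Definition quadrant {R : realDomainType} (x y : R) : bool * bool :=
  (0 <= y, 0 <= x).

(** An edge between the two lower quadrants. *)
Definition split_edge (l l' : bool * bool) : bool :=
  [&& ~~ l.1, ~~ l'.1 & l.2 (+) l'.2].

Definition split_parity (n : nat) (l : nat -> bool * bool) : bool :=
  \big[addb/false]_(i < n) split_edge (l i) (l i.+1).

Lemma split_parity_upper (n : nat) (l : nat -> bool * bool) :
  (forall i, (i <= n)%N -> (l i).1) -> split_parity n l = false.
Proof.
move=> H; rewrite /split_parity big1// => i _.
by rewrite /split_edge H// ltnW.
Qed.

Lemma split_parity_side (b : bool) (n : nat) (l : nat -> bool * bool) :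
  (forall i, (i <= n)%N -> (l i).2 = b) -> split_parity n l = false.
Proof.
move=> H; rewrite /split_parity big1// => i _.
by rewrite /split_edge !H ?addbb ?andbF// ltnW.
Qed.

Lemma split_parity_lower (n : nat) (l : nat -> bool * bool) :
  (forall i, (i <= n)%N -> ~~ (l i).1) ->
  split_parity n l = (l 0%N).2 (+) (l n).2.
Proof.
rewrite /split_parity; elim: n => [|n IHn] H; first by rewrite big_ord0 addbb.
rewrite big_ord_recr/= IHn => [|i ilen]; last by apply: H; rewrite ltnW.
rewrite /split_edge (negPf (H _ (leqnSn n))) (negPf (H _ (leqnn _)))/=.
by rewrite -addbA addKb.
Qed.

Lemma eq_split_parity (n : nat) (l l' : nat -> bool * bool) :
  (forall i, (i <= n)%N -> l i = l' i) -> split_parity n l = split_parity n l'.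
Proof.
move=> H; apply: eq_bigr => i _; rewrite !H//; exact: ltnW.
Qed.

(** A triangle has an odd number of edges joining the two lower quadrants
    exactly when its vertices lie in the three sectors; then the vertex in the
    lower left quadrant is within [eta] of the origin. *)
Lemma split_parity_triangle (R : realDomainType) (eta x1 y1 x2 y2 x3 y3 : R) :
  `|x1 - x2| < eta -> `|x2 - x3| < eta -> `|x1 - x3| < eta ->
  `|y1 - y2| < eta -> `|y2 - y3| < eta -> `|y1 - y3| < eta ->
  ~ (`|x1| < eta /\ `|y1| < eta) -> ~ (`|x2| < eta /\ `|y2| < eta) ->
  ~ (`|x3| < eta /\ `|y3| < eta) ->
  split_edge (quadrant x1 y1) (quadrant x2 y2) (+)
  split_edge (quadrant x2 y2) (quadrant x3 y3) =
  split_edge (quadrant x1 y1) (quadrant x3 y3).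
Proof.
move=> a1 a2 a3 b1 b2 b3 h1 h2 h3; rewrite /split_edge /quadrant/=.
have hit xB yB xC yA : `|xB - xC| < eta -> `|yB - yA| < eta ->
    0 <= yA -> yB < 0 -> xB < 0 -> 0 <= xC -> `|xB| < eta /\ `|yB| < eta.
  move=> hx hy yA0 yB0 xB0 xC0; split.
    by move: hx; rewrite (ltr0_norm xB0) ltr0_norm; lra.
  by move: hy; rewrite (ltr0_norm yB0) ltr0_norm; lra.
case: (leP 0 y1) => p1; case: (leP 0 y2) => p2; case: (leP 0 y3) => p3 //=;
case: (leP 0 x1) => q1; case: (leP 0 x2) => q2; case: (leP 0 x3) => q3 //=;
exfalso; first [ by apply: h1; apply: (hit _ _ x2 y3)
  | by apply: h1; apply: (hit _ _ x3 y2)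
  | by apply: h2; apply: (hit _ _ x1 y3); rewrite // distrC
  | by apply: h2; apply: (hit _ _ x3 y1); rewrite // distrC
  | by apply: h3; apply: (hit _ _ x1 y2); rewrite // distrC
  | by apply: h3; apply: (hit _ _ x2 y1); rewrite // distrC].
Qed.

(** Cutting each cell of the grid by a diagonal, every triangle has an even
    number of split edges, and each inner edge belongs to two triangles; so
    the number of split edges on the boundary is even. *)
Lemma split_parity_grid (R : realDomainType) (M K : nat) (eta : R)
    (X Y : nat -> nat -> R) :
  (forall i j i' j', (i <= i' <= i.+1)%N -> (j <= j' <= j.+1)%N ->
     (i' <= M)%N -> (j' <= K)%N ->
     `|X i j - X i' j'| < eta /\ `|Y i j - Y i' j'| < eta) ->
  (forall i j, (i <= M)%N -> (j <= K)%N ->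
     ~ (`|X i j| < eta /\ `|Y i j| < eta)) ->
  let l i j := quadrant (X i j) (Y i j) in
  split_parity M (l^~ 0%N) (+) split_parity M (l^~ K) =
  split_parity K (l 0%N) (+) split_parity K (l M).
Proof.
move=> var nohit l.
have cell i j : (i < M)%N -> (j < K)%N ->
    split_edge (l i j) (l i.+1 j) (+) split_edge (l i.+1 j) (l i.+1 j.+1) =
    split_edge (l i j) (l i j.+1) (+) split_edge (l i j.+1) (l i.+1 j.+1).
  move=> iM jK.
  have [iM' jK'] := (ltnW iM, ltnW jK).
  have [h1 h1'] : `|X i j - X i.+1 j| < eta /\ `|Y i j - Y i.+1 j| < eta.
    by apply: var; rewrite ?leqnn ?leqnSn.
  have [h2 h2'] : `|X i j - X i j.+1| < eta /\ `|Y i j - Y i j.+1| < eta.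
    by apply: var; rewrite ?leqnn ?leqnSn.
  have [h3 h3'] : `|X i j - X i.+1 j.+1| < eta /\
                  `|Y i j - Y i.+1 j.+1| < eta.
    by apply: var; rewrite ?leqnn ?leqnSn.
  have [h4 h4'] : `|X i.+1 j - X i.+1 j.+1| < eta /\
                  `|Y i.+1 j - Y i.+1 j.+1| < eta.
    by apply: var; rewrite ?leqnn ?leqnSn.
  have [h5 h5'] : `|X i j.+1 - X i.+1 j.+1| < eta /\
                  `|Y i j.+1 - Y i.+1 j.+1| < eta.
    by apply: var; rewrite ?leqnn ?leqnSn.
  rewrite (@split_parity_triangle _ eta)//; try exact: nohit.
  by rewrite (@split_parity_triangle _ eta)//; exact: nohit.
have strip j : (j < K)%N ->
    split_parity M (l^~ j) (+) split_parity M (l^~ j.+1) =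
    split_edge (l 0%N j) (l 0%N j.+1) (+) split_edge (l M j) (l M j.+1).
  move=> jK; suff H m : (m <= M)%N ->
    split_parity m (l^~ j) (+) split_parity m (l^~ j.+1) =
    split_edge (l 0%N j) (l 0%N j.+1) (+) split_edge (l m j) (l m j.+1).
    exact: H.
  rewrite /split_parity; elim: m => [|m IHm] mM.
    by rewrite !big_ord0 !addbb.
  rewrite !big_ord_recr/= addbACA (IHm (ltnW mM)).
  move: (cell m j mM jK).
  by do 5!case: (split_edge _ _).
suff H k : (k <= K)%N ->
    split_parity M (l^~ 0%N) (+) split_parity M (l^~ k) =
    split_parity k (l 0%N) (+) split_parity k (l M).
  exact: H.
elim: k => [|k IHk] kK; first by rewrite /split_parity !big_ord0 !addbb.
rewrite [split_parity k.+1 (l 0%N)]/split_parity.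
rewrite [split_parity k.+1 (l M)]/split_parity.
rewrite !big_ord_recr/= addbACA -(strip k kK) -!/(split_parity _ _).
rewrite -(IHk (ltnW kK)).
by do 3!case: (split_parity _ _).
Qed.

(** * Comparison triangles in the model planes *)

(** What the comparison needs from trigonometry, common to the sphere ([sg =
    1], [cos], [sin], [acos]) and the hyperbolic plane ([sg = -1], [cosh],
    [sinh], [acosh]) of curvature [sg]. Lengths up to [L] are considered.
    Since [C] decreases on the sphere and increases on the hyperbolic plane,
    order statements are about [sg * C]. *)
Record polar_trig (R : realType) (sg L : R) (C S arcC : R -> R) : Prop := {
  pt_sg : sg * sg = 1 ;
  pt_C0 : C 0 = 1 ;
  pt_CN : forall x, C (- x) = C x ;
  pt_SN : forall x, S (- x) = - S x ;
  pt_CB : forall x y, C (x - y) = C x * C y + sg * (S x * S y) ;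
  pt_SB : forall x y, S (x - y) = S x * C y - C x * S y ;
  pt_S_gt0 : forall x, 0 < x < L -> 0 < S x ;
  pt_C_ge0 : forall x, 0 <= x <= L / 2 -> 0 <= C x ;
  pt_arcK : forall x, 0 <= x <= L -> arcC (C x) = x ;
  pt_arc_le : forall c z, 0 <= c <= L -> sg * C c <= sg * z -> sg * z <= sg ->
    arcC z <= c }.

Definition vec3 (R : realType) (x y z : R) : 'rV[R]_3 :=
  \row_(i < 3) [:: x; y; z]`_i.

(** The Euclidean form for [sg = 1] and the opposite of the Lorentz form for
    [sg = -1]; in both models [form3 sg u v] is [C] of the distance. *)
Definition form3 (R : realType) (sg : R) (u v : 'rV[R]_3) : R :=
  u 0 0 * v 0 0 + sg * (u 0 1 * v 0 1 + u 0 2%:R * v 0 2%:R).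

Lemma vec3E (R : realType) (x y z : R) :
  (vec3 x y z 0 0 = x) * (vec3 x y z 0 1 = y) * (vec3 x y z 0 2%:R = z).
Proof. by rewrite !mxE. Qed.

Section polar_trig_theory.
Context {R : realType} {sg L : R} {C S arcC : R -> R}.
Hypothesis pt : polar_trig sg L C S arcC.

Lemma pt_S0 : S 0 = 0.
Proof. by have := pt_SB pt 0 0; rewrite subr0 mulrC subrr. Qed.

Lemma pt_CS x : C x * C x + sg * (S x * S x) = 1.
Proof. by rewrite -(pt_CB pt) subrr (pt_C0 pt). Qed.

Lemma pt_CD x y : C (x + y) = C x * C y - sg * (S x * S y).
Proof. by rewrite -[y in LHS]opprK (pt_CB pt) (pt_CN pt) (pt_SN pt); ring. Qed.

Lemma pt_SD x y : S (x + y) = S x * C y + C x * S y.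
Proof. by rewrite -[y in LHS]opprK (pt_SB pt) (pt_CN pt) (pt_SN pt); ring. Qed.

Lemma pt_S_ge0 x : 0 <= x -> x < L -> 0 <= S x.
Proof.
rewrite le_eqVlt => /predU1P[<- _|x0 xL]; first by rewrite pt_S0.
by rewrite ltW// (pt_S_gt0 pt)// x0.
Qed.

(** [sg * C x - sg * C y] is twice the product of the sines of the half-sum
    and of the half-difference of [x] and [y]. *)
Lemma pt_C_anti x y : 0 <= x -> x <= y -> y < L -> sg * C y <= sg * C x.
Proof.
move=> x0 xy yL.
have -> : x = (y + x) / 2 - (y - x) / 2 by field.
have {1}-> : y = (y + x) / 2 + (y - x) / 2 by field.
set m := (y + x) / 2; set h := (y - x) / 2.
have := pt_sg pt; have : 0 <= S m * S h.
  by apply: mulr_ge0; apply: pt_S_ge0; rewrite /m /h; lra.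
rewrite (pt_CB pt) pt_CD; set P := S m * S h; set Q := C m * C h => P0 sg1.
have -> : sg * (Q - sg * P) = sg * Q - sg * sg * P by ring.
have -> : sg * (Q + sg * P) = sg * Q + sg * sg * P by ring.
by rewrite sg1; lra.
Qed.

Lemma pt_S_mono x y : 0 <= x -> x <= y -> y <= L / 2 -> y < L -> S x <= S y.
Proof.
move=> x0 xy yL yL'.
have -> : y = (y + x) / 2 + (y - x) / 2 by field.
have {1}-> : x = (y + x) / 2 - (y - x) / 2 by field.
set m := (y + x) / 2; set h := (y - x) / 2.
have : 0 <= C m * S h.
  by apply: mulr_ge0; [apply: (pt_C_ge0 pt)|apply: pt_S_ge0];
    rewrite /m /h; lra.
rewrite (pt_SB pt) pt_SD; lra.
Qed.

Lemma pt_C_norm x : C `|x| = C x.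
Proof. by case: (ler0P x) => // _; rewrite (pt_CN pt). Qed.

(** The triangle has its first vertex at the pole and its sides [g0], [g2] on
    two meridians at an angle with cosine [x1], given by the law of cosines.
    By the same law, [sg * C] of the distance between the points at fraction
    [t] of the two sides is [sg * C (t * (a - b)) - (1 - x1) * (S (t * a) * S
    (t * b))], which is antitone in [t]: so this distance is largest for [t =
    1]. The third side [g1] is given by spherical interpolation between its
    endpoints, or by its hyperbolic analogue. *)
Lemma polar_comparison (a b c : R) :
  0 < a -> 0 < b -> 0 < c -> c <= a + b -> a <= b + c -> b <= a + c ->
  a <= L / 2 -> b <= L / 2 -> a + b < L ->
  exists x1 x2 : R, let g0 t := vec3 (C t) (S t) 0 in
    let g2 t := vec3 (C t) (x1 * S t) (x2 * S t) in
    let g1 t := (S c)^-1 *: (S (c - t) *: g0 a + S t *: g2 b) in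
  [/\ g1 0 = g0 a /\ g1 c = g2 b,
    forall s t, form3 sg (g0 s) (g0 t) = C (s - t),
    forall s t, form3 sg (g1 s) (g1 t) = C (s - t),
    forall s t, form3 sg (g2 s) (g2 t) = C (s - t)
  & forall t, 0 <= t <= 1 -> arcC (form3 sg (g0 (t * a)) (g2 (t * b))) <= c].
Proof.
move=> a0 b0 c0 cab abc bac aL bL abL.
have cL : c < L by lra.
have Sa0 : 0 < S a by rewrite (pt_S_gt0 pt)// a0/=; lra.
have Sb0 : 0 < S b by rewrite (pt_S_gt0 pt)// b0/=; lra.
have Sc0 : 0 < S c by rewrite (pt_S_gt0 pt)// c0.
have Sab0 : 0 < S a * S b by rewrite mulr_gt0.
(* the cosine of the angle at the pole *)
pose x1 := sg * (C c - C a * C b) / (S a * S b).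
have x1E : sg * x1 * (S a * S b) = C c - C a * C b.
  by rewrite /x1 -mulrA divfK ?gt_eqF// mulrA (pt_sg pt) mul1r.
have x1_le1 : x1 <= 1.
  rewrite ler_pdivrMr// mul1r.
  have : sg * C c <= sg * C `|a - b|.
    by apply: pt_C_anti => //; rewrite ler_norml; lra.
  rewrite pt_C_norm (pt_CB pt) => h.
  rewrite mulrBr lerBlDl (le_trans h)//.
  by rewrite mulrDr (mulrA sg sg) (pt_sg pt) mul1r lexx.
have x1_geN1 : -1 <= x1.
  rewrite ler_pdivlMr// mulN1r.
  have : sg * C (a + b) <= sg * C c by apply: pt_C_anti => //; lra.
  rewrite pt_CD => h.
  rewrite mulrBr lerBrDl (le_trans _ h)//.
  by rewrite mulrBr (mulrA sg sg) (pt_sg pt) mul1r lexx.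
pose x2 := Num.sqrt (1 - x1 ^+ 2).
have x12 : x1 * x1 + x2 * x2 = 1.
  rewrite -[x2 * x2]expr2 sqr_sqrtr; first by rewrite expr2; ring.
  by rewrite subr_ge0 expr2; nra.
exists x1, x2 => g0 g2 g1.
have CSa := pt_CS a; have CSb := pt_CS b; have CSc := pt_CS c.
split.
- split; rewrite /g1.
    by rewrite subr0 pt_S0 scale0r addr0 scalerA mulVf ?gt_eqF// scale1r.
  by rewrite subrr pt_S0 scale0r add0r scalerA mulVf ?gt_eqF// scale1r.
- by move=> s t; rewrite /form3 !vec3E (pt_CB pt) mul0r addr0.
- move=> s t.
  have form_lin u v u' v' : form3 sg ((S c)^-1 *: (u *: g0 a + v *: g2 b))
      ((S c)^-1 *: (u' *: g0 a + v' *: g2 b)) =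
      (S c)^-1 ^+ 2 * (u * u' + v * v' + (u * v' + v * u') * C c).
    have -> : C c = C a * C b + sg * x1 * (S a * S b) by rewrite x1E; ring.
    rewrite /form3 /g0 /g2 !mxE/=.
    transitivity ((S c)^-1 ^+ 2 * (u * u' * (C a * C a + sg * (S a * S a)) +
      v * v' * (C b * C b + (x1 * x1 + x2 * x2) * (sg * (S b * S b))) +
      (u * v' + v * u') * (C a * C b + sg * x1 * (S a * S b)))); first ring.
    by rewrite x12 mul1r CSa CSb !mulr1.
  rewrite /g1 form_lin !(pt_SB pt) (pt_CB pt).
  transitivity ((S c)^-1 ^+ 2 * (S c * S c * (C s * C t) +
     S s * S t * (1 - C c * C c))); first ring.
  have -> : 1 - C c * C c = sg * (S c * S c) by rewrite -CSc; ring.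
  by field; rewrite gt_eqF.
- move=> s t; rewrite /form3 !vec3E (pt_CB pt).
  transitivity (C s * C t + (x1 * x1 + x2 * x2) * (sg * (S s * S t))).
    ring.
  by rewrite x12 mul1r.
- move=> t /andP[t0 t1].
  have zE s : sg * form3 sg (g0 (s * a)) (g2 (s * b)) =
      sg * C (s * (a - b)) - (1 - x1) * (S (s * a) * S (s * b)).
    rewrite /form3 !vec3E mulrBr (pt_CB pt) mul0r addr0 mulrDr.
    rewrite mulrA [sg * (sg * _)]mulrA (pt_sg pt) mul1r.
    rewrite mulrDr [sg * (sg * _)]mulrA (pt_sg pt) mul1r; ring.
  have ta : t * a <= a by rewrite ler_piMl// ltW.
  have tb : t * b <= b by rewrite ler_piMl// ltW.
  have ta0 : 0 <= t * a by rewrite mulr_ge0// ltW.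
  have tb0 : 0 <= t * b by rewrite mulr_ge0// ltW.
  have aL' : a < L by apply: lt_trans abL; rewrite ltrDl.
  have bL' : b < L by apply: lt_trans abL; rewrite ltrDr.
  have Sta : 0 <= S (t * a) by apply: pt_S_ge0 => //; exact: le_lt_trans aL'.
  have Stb : 0 <= S (t * b) by apply: pt_S_ge0 => //; exact: le_lt_trans bL'.
  have SS0 : 0 <= S (t * a) * S (t * b) by exact: mulr_ge0.
  have SS1 : S (t * a) * S (t * b) <= S a * S b.
    by apply: ler_pM => //; exact: pt_S_mono.
  have absL : `|a - b| < L by rewrite ltr_norml; lra.
  have tab : `|t * (a - b)| <= `|a - b| by rewrite normrM ger0_norm// ler_piMl.
  apply: (pt_arc_le pt); first by rewrite !ltW.
    have := zE 1; rewrite !mul1r => z1.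
    have {z1} : sg * form3 sg (g0 a) (g2 b) = sg * C c.
      rewrite /form3 !vec3E mul0r addr0; congr (_ * _).
      by rewrite -[C c](subrK (C a * C b)) -x1E; ring.
    have := zE 1; rewrite !mul1r => -> <-.
    rewrite zE lerB//; last by rewrite ler_wpM2l// subr_ge0.
    by rewrite -(pt_C_norm (a - b)) -(pt_C_norm (t * _)) pt_C_anti.
  rewrite zE lerBlDr -[leLHS]addr0; apply: lerD; last first.
    by rewrite mulr_ge0// subr_ge0.
  rewrite -(pt_C_norm (t * _)) -[leRHS]mulr1 -(pt_C0 pt) pt_C_anti//.
  exact: le_lt_trans tab absL.
Qed.

End polar_trig_theory.

Lemma polar_trig_sphere (R : realType) : polar_trig 1 pi cos sin (@acos R).
Proof.
have pi0 := pi_gt0 R.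
split.
- by rewrite mulr1.
- exact: cos0.
- exact: cosN.
- exact: sinN.
- by move=> x y; rewrite cosB mul1r.
- by move=> x y; rewrite sinB.
- by move=> x; exact: sin_gt0_pi.
- by move=> x /andP[x0 x1]; apply: cos_ge0_pihalf; apply/andP; split => //; lra.
- by move=> x x01; apply: cosK; rewrite in_itv.
- move=> c z c01; rewrite !mul1r => cz z1.
  have zitv : z \in `[(-1), 1].
    by rewrite in_itv/= z1 andbT (le_trans _ cz)// cos_geN1.
  rewrite leNgt; apply/negP => lt_cz.
  suff : cos (acos z) < cos c by rewrite acosK// ltNge cz.
  rewrite ltr_cos// in_itv//= acos_lepi ?acos_ge0//; exact: zitv.
Qed.

Definition cosh (R : realType) (x : R) : R := (expR x + expR (- x)) / 2.
Definition sinh (R : realType) (x : R) : R := (expR x - expR (- x)) / 2.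

Lemma expRV1 (R : realType) (x : R) : expR x * expR (- x) = 1.
Proof. by rewrite -expRD subrr expR0. Qed.

Lemma sinh_gt0 (R : realType) (x : R) : 0 < x -> 0 < sinh x.
Proof. by move=> x0; rewrite divr_gt0// subr_gt0 ltr_expR; lra. Qed.

Lemma cosh_gt0 (R : realType) (x : R) : 0 < cosh x.
Proof. by rewrite divr_gt0// addr_gt0// expR_gt0. Qed.

Lemma acosh_cosh (R : realType) (x : R) : 0 <= x -> acosh (cosh x) = x.
Proof.
move=> x0; rewrite /acosh.
have -> : cosh x ^+ 2 - 1 = sinh x ^+ 2.
  by rewrite -(expRV1 x) /cosh /sinh; field.
rewrite sqrtr_sqr ger0_norm; last first.
  by rewrite divr_ge0// subr_ge0 ler_expR; lra.
have -> : cosh x + sinh x = expR x by rewrite /cosh /sinh; field.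
exact: expRK.
Qed.

Lemma acosh_le (R : realType) (x y : R) :
  1 <= x -> x <= y -> acosh x <= acosh y.
Proof.
move=> x1 xy; rewrite /acosh ler_ln ?posrE.
- by rewrite lerD// ler_wsqrtr// lerB// ler_sqr// nnegrE; lra.
- by rewrite ltr_wpDr ?sqrtr_ge0//; lra.
- by rewrite ltr_wpDr ?sqrtr_ge0//; lra.
Qed.

Lemma polar_trig_hyperbolic (R : realType) (L : R) :
  polar_trig (-1) L (@cosh R) (@sinh R) (@acosh R).
Proof.
split.
- by rewrite mulrNN mulr1.
- by rewrite /cosh oppr0 expR0; field.
- by move=> x; rewrite /cosh opprK addrC.
- by move=> x; rewrite /sinh opprK -mulNr opprB.
- by move=> x y; rewrite /cosh /sinh opprB expRD (addrC y) expRD; field.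
- by move=> x y; rewrite /cosh /sinh opprB expRD (addrC y) expRD; field.
- by move=> x /andP[x0 _]; exact: sinh_gt0.
- by move=> x _; exact: ltW (cosh_gt0 x).
- by move=> x /andP[x0 _]; exact: acosh_cosh.
- move=> c z /andP[c0 _]; rewrite !mulN1r lerN2 lerN2 => zc z1.
  by rewrite -[leRHS]acosh_cosh// acosh_le.
Qed.

Lemma dot3E (R : realType) (u v : 'rV[R]_3) :
  dot3 u v = u 0 0 * v 0 0 + (u 0 1 * v 0 1 + u 0 2%:R * v 0 2%:R).
Proof.
rewrite /dot3 !big_ord_recl big_ord0 addr0.
by congr (_ * _ + (_ * _ + _ * _)); congr (fun_of_matrix _ _ _); exact: val_inj.
Qed.

Lemma model_dist_pos (R : realType) (kappa : R) (u v : 'rV[R]_3) : 0 < kappa ->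
  model_dist kappa u v = acos (form3 1 u v) / Num.sqrt kappa.
Proof. by move=> k0; rewrite /model_dist k0 /form3 mul1r dot3E. Qed.

Lemma model_dist_neg (R : realType) (kappa : R) (u v : 'rV[R]_3) : kappa < 0 ->
  model_dist kappa u v = acosh (form3 (-1) u v) / Num.sqrt (- kappa).
Proof.
move=> k0; rewrite /model_dist ltNge (ltW k0)/= k0 /form3 /lorentz3 dot3E.
by congr (acosh _ / _); ring.
Qed.

Definition unit_speed (R : realType) (T : Type) (d : T -> T -> R) (A : set T)
    (l : R) (g : R -> T) :=
  (forall t, 0 <= t <= l -> A (g t)) /\
  (forall s t, 0 <= s <= l -> 0 <= t <= l -> d (g s) (g t) = `|s - t|).

(** Rescaling the distance by [1 / k] adjusts the curvature from [sg] to [sg *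
    k ^+ 2]. *)
Lemma polar_unit_speed (R : realType) (sg L k : R) (C S arcC : R -> R)
    (d : 'rV[R]_3 -> 'rV[R]_3 -> R) (A : set 'rV[R]_3)
    (l : R) (g : R -> 'rV[R]_3) :
  polar_trig sg L C S arcC -> 0 < k ->
  (forall u v, d u v = arcC (form3 sg u v) / k) ->
  k * l <= L -> (forall s t, form3 sg (g s) (g t) = C (s - t)) ->
  (forall t, 0 <= t <= k * l -> A (g t)) ->
  unit_speed d A l (fun t => g (k * t)).
Proof.
move=> pt k0 dE klL gE gA; split.
  move=> t /andP[t0 tl]; apply: gA; rewrite mulr_ge0 ?ler_pM2l//; exact: ltW.
move=> s t /andP[s0 sl] /andP[t0 tl].
rewrite dE gE -(pt_C_norm pt) -mulrBr (pt_arcK pt).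
  by rewrite normrM gtr0_norm// mulrC mulKf// gt_eqF.
rewrite normr_ge0/= (le_trans _ klL)// normrM gtr0_norm// ler_pM2l//.
by rewrite ler_norml; lra.
Qed.

(** Two sides of this length issuing from a point, and the distance of their
    endpoints, stay below the diameter of the model plane; the rescaled sides are
    shorter than a right angle, where the sine is monotone. *)
Definition cone_radius (R : realType) (kappa r : R) : Prop :=
  0 < kappa -> r * Num.sqrt kappa < pi / 2.

Lemma model_comparison_curved (R : realType) (sg L k a b c r : R)
    (C S arcC : R -> R)
    (d : 'rV[R]_3 -> 'rV[R]_3 -> R) (A : set 'rV[R]_3) :
  polar_trig sg L C S arcC -> 0 < k -> r * k < L / 2 ->
  (forall u v, d u v = arcC (form3 sg u v) / k) ->
  (forall u, form3 sg u u = 1 -> (sg = 1 \/ 0 < u 0 0) -> A u) ->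
  (sg = 1 \/ forall x, 0 < C x) ->
  0 < a -> 0 < b -> 0 < c -> c <= a + b -> a <= b + c -> b <= a + c ->
  a <= r -> b <= r ->
  exists g0 g1 g2 : R -> 'rV[R]_3,
  [/\ [/\ g0 0 = g2 0, g1 0 = g0 a & g1 c = g2 b],
    unit_speed d A a g0, unit_speed d A c g1, unit_speed d A b g2
  & forall t, 0 <= t <= 1 -> d (g0 (t * a)) (g2 (t * b)) <= c].
Proof.
move=> pt k0 rL dE AE Cpos a0 b0 c0 cab abc bac ar br.
have ka0 : 0 < k * a by rewrite mulr_gt0.
have kb0 : 0 < k * b by rewrite mulr_gt0.
have kc0 : 0 < k * c by rewrite mulr_gt0.
have kar : k * a <= r * k by rewrite mulrC ler_wpM2r// ltW.
have kbr : k * b <= r * k by rewrite mulrC ler_wpM2r// ltW.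
have kcab : k * c <= k * a + k * b by rewrite -mulrDr ler_wpM2l// ltW.
have [||||||x1 [x2 /= [[g1E g1E'] h0 h1 h2 hle]]] :=
  polar_comparison pt ka0 kb0 kc0.
- by [].
- by rewrite -mulrDr ler_wpM2l// ltW.
- by rewrite -mulrDr ler_wpM2l// ltW.
- lra.
- lra.
- lra.
pose g0 t := vec3 (C t) (S t) 0.
pose g2 t := vec3 (C t) (x1 * S t) (x2 * S t).
pose g1 t :=
  (S (k * c))^-1 *: (S (k * c - t) *: g0 (k * a) + S t *: g2 (k * b)).
rewrite -/(g0 _) -/(g2 _) in g1E g1E'.
exists (fun t => g0 (k * t)), (fun t => g1 (k * t)), (fun t => g2 (k * t)).
split.
- split; first by rewrite /g0 /g2 mulr0 (pt_S0 pt) !mulr0.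
    by rewrite /g1 mulr0 g1E.
  by rewrite /g1 g1E'.
- apply: (polar_unit_speed pt) => //; first lra.
  move=> t _; apply: AE; first by rewrite h0 subrr (pt_C0 pt).
  by case: Cpos => [->|Cp]; [left|right; rewrite /g0 vec3E].
- apply: (polar_unit_speed pt) => //; first lra.
  move=> t /andP[t0 tc]; apply: AE; first by rewrite h1 subrr (pt_C0 pt).
  case: Cpos => [->|Cp]; [by left|right].
  have Sc : 0 < S (k * c) by rewrite (pt_S_gt0 pt)// kc0/=; lra.
  rewrite /g1 !mxE/= mulr_gt0 ?invr_gt0//.
  have St : 0 <= S t by apply: (pt_S_ge0 pt) => //; lra.
  have [tltc|cltt] := ltP t (k * c).
    rewrite ltr_pwDl ?mulr_ge0 ?mulr_gt0 ?(ltW (Cp _))//.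
    by rewrite (pt_S_gt0 pt)// subr_gt0 tltc/=; lra.
  rewrite ltr_wpDl//.
    rewrite mulr_ge0 ?(ltW (Cp _))// (pt_S_ge0 pt)//; lra.
  by rewrite mulr_gt0// (_ : t = k * c)//; apply/eqP; rewrite eq_le tc.
- apply: (polar_unit_speed pt) => //; first lra.
  move=> t _; apply: AE; first by rewrite h2 subrr (pt_C0 pt).
  by case: Cpos => [->|Cp]; [left|right; rewrite /g2 vec3E].
- move=> t t01; rewrite dE ler_pdivrMr// (mulrC c) !(mulrCA k t).
  exact: hle.
Qed.

(** Here the distance between the points at fraction [t] of the two sides is
    exactly [t * c]. *)
Lemma model_comparison_flat (R : realType) (a b c : R) :
  0 < a -> 0 < b -> 0 < c -> c <= a + b -> a <= b + c -> b <= a + c ->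
  exists g0 g1 g2 : R -> 'rV[R]_3,
  [/\ [/\ g0 0 = g2 0, g1 0 = g0 a & g1 c = g2 b],
    unit_speed (model_dist 0) (model_plane 0) a g0,
    unit_speed (model_dist 0) (model_plane 0) c g1,
    unit_speed (model_dist 0) (model_plane 0) b g2
  & forall t, 0 <= t <= 1 -> model_dist 0 (g0 (t * a)) (g2 (t * b)) <= c].
Proof.
move=> a0 b0 c0 cab abc bac.
have dE (u v : 'rV[R]_3) : model_dist 0 u v = Num.sqrt (dot3 (u - v) (u - v)).
  by rewrite /model_dist !ltxx.
pose x1 := (a ^+ 2 + b ^+ 2 - c ^+ 2) / (2 * a * b).
have ab0 : 0 < 2 * a * b by rewrite !mulr_gt0.
have x1E : 2 * a * b * x1 = a ^+ 2 + b ^+ 2 - c ^+ 2.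
  by rewrite /x1 mulrC divfK ?gt_eqF.
have x1_le1 : x1 <= 1 by rewrite ler_pdivrMr// !expr2; nra.
have x1_geN1 : -1 <= x1 by rewrite ler_pdivlMr// !expr2; nra.
pose x2 := Num.sqrt (1 - x1 ^+ 2).
have x12 : x1 * x1 + x2 * x2 = 1.
  rewrite -[x2 * x2]expr2 sqr_sqrtr; first by rewrite expr2; ring.
  by rewrite subr_ge0 expr2; nra.
have speed l g : (forall t, (g t : 'rV[R]_3) 0 0 = 0) ->
    (forall s t, dot3 (g s - g t) (g s - g t) = (s - t) ^+ 2) ->
    unit_speed (model_dist 0) (model_plane 0) l g.
  move=> g0 gE; split=> [t _|s t _ _].
    by rewrite /model_plane/= !ltxx.
  by rewrite dE gE sqrtr_sqr.
exists (fun t => vec3 0 t 0),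
  (fun t => vec3 0 (a + t / c * (x1 * b - a)) (t / c * (x2 * b))),
  (fun t => vec3 0 (x1 * t) (x2 * t)).
split.
- split; first by rewrite !mulr0.
    by rewrite !mul0r addr0.
  by rewrite divff ?gt_eqF// !mul1r subrKC.
- apply: speed => [t|s t]; first by rewrite !mxE.
  by rewrite dot3E !mxE/=; ring.
- apply: speed => [t|s t]; first by rewrite !mxE.
  rewrite dot3E !mxE/=.
  transitivity (((s - t) / c) ^+ 2 * (a ^+ 2 + (x1 * x1 + x2 * x2) * b ^+ 2 -
     2 * a * b * x1)); first ring.
  by rewrite x12 x1E; field; rewrite gt_eqF.
- apply: speed => [t|s t]; first by rewrite !mxE.
  rewrite dot3E !mxE/=.
  transitivity ((x1 * x1 + x2 * x2) * (s - t) ^+ 2); first ring.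
  by rewrite x12 mul1r.
- move=> t /andP[t0 t1]; rewrite dE dot3E !mxE/=.
  have -> : (0 - 0) * (0 - 0) + ((t * a - x1 * (t * b)) * (t * a - x1 * (t * b)) +
      (0 - x2 * (t * b)) * (0 - x2 * (t * b))) =
     t ^+ 2 * (a ^+ 2 + (x1 * x1 + x2 * x2) * b ^+ 2 - 2 * a * b * x1) by ring.
  rewrite x12 x1E.
  have -> : t ^+ 2 * (a ^+ 2 + 1 * b ^+ 2 - (a ^+ 2 + b ^+ 2 - c ^+ 2)) =
    (t * c) ^+ 2 by ring.
  by rewrite sqrtr_sqr ger0_norm ?mulr_ge0 ?(ltW c0)// ler_piMl// ltW.
Qed.

Lemma model_comparison (R : realType) (kappa r a b c : R) :
  cone_radius kappa r -> 0 < a -> 0 < b -> 0 < c ->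
  c <= a + b -> a <= b + c -> b <= a + c -> a <= r -> b <= r ->
  exists g0 g1 g2 : R -> 'rV[R]_3,
  [/\ [/\ g0 0 = g2 0, g1 0 = g0 a & g1 c = g2 b],
    unit_speed (model_dist kappa) (model_plane kappa) a g0,
    unit_speed (model_dist kappa) (model_plane kappa) c g1,
    unit_speed (model_dist kappa) (model_plane kappa) b g2
  & forall t, 0 <= t <= 1 ->
      model_dist kappa (g0 (t * a)) (g2 (t * b)) <= c].
Proof.
move=> kr a0 b0 c0 cab abc bac ar br.
case: (ltrgtP 0 kappa) => [k0|k0|<-]; last exact: model_comparison_flat.
- apply: (@model_comparison_curved _ 1 pi (Num.sqrt kappa) _ _ _ r cos sin
    (@acos R)) => //.
  + exact: polar_trig_sphere.
  + by rewrite sqrtr_gt0.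
  + exact: kr.
  + by move=> u v; rewrite model_dist_pos.
  + by move=> u uu _; rewrite /model_plane/= k0 dot3E -uu /form3 mul1r.
  + by left.
- apply: (@model_comparison_curved _ (-1) (2 * (r * Num.sqrt (- kappa)) + 1)
    (Num.sqrt (- kappa)) _ _ _ r (@cosh R) (@sinh R) (@acosh R)) => //.
  + exact: polar_trig_hyperbolic.
  + by rewrite sqrtr_gt0 oppr_gt0.
  + lra.
  + by move=> u v; rewrite model_dist_neg.
  + move=> u uu [|u0]; first lra.
    rewrite /model_plane/= ltNge (ltW k0)/= k0; split => //.
    by move: uu; rewrite /lorentz3 dot3E /form3; lra.
  + by right=> x; exact: cosh_gt0.
Qed.

(** * Geodesic cones contract *)

Definition tri3 (T : Type) (x y z : T) (i : 'I_3) : T :=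
  match val i with 0%N => x | 1%N => y | _ => z end.

Lemma geodesic_triangle_tri3 (R : realType) (T : Type) (d : T -> T -> R)
    (A : set T) (x y z : T) (cx cy cz : R -> T) :
  geodesic d A x y cx -> geodesic d A y z cy -> geodesic d A z x cz ->
  geodesic_triangle d A (tri3 x y z) (tri3 cx cy cz).
Proof. by move=> ? ? ?; case=> [[|[|[|//]]] ?]. Qed.

Lemma unit_speed_dist (R : realType) (T : Type) (d : T -> T -> R)
    (A : set T) (l : R) (g : R -> T) : 0 <= l -> unit_speed d A l g ->
  d (g 0) (g l) = l /\ d (g l) (g 0) = l.
Proof.
move=> l0 [_ gd]; rewrite !gd ?lexx ?l0//.
by rewrite sub0r subr0 normrN ger0_norm.
Qed.

Lemma unit_speed_geodesic (R : realType) (T : Type) (d : T -> T -> R)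
    (A : set T) (l : R) (g : R -> T) : 0 <= l -> unit_speed d A l g ->
  geodesic d A (g 0) (g l) g.
Proof.
move=> l0 gus; have [dl _] := unit_speed_dist l0 gus; case: gus => gA gd.
by rewrite /geodesic dl; split.
Qed.

Lemma geodesic_unit_speed (R : realType) (T : Type) (d : T -> T -> R)
    (A : set T) (x y : T) (g : R -> T) :
  geodesic d A x y g -> unit_speed d A (d x y) g.
Proof.
by move=> [_ _ gA gd]; split => [t tl|s t sl tl]; [apply: gA|apply: gd];
  rewrite in_itv.
Qed.

Lemma unit_speed_rev (R : realType) (T : Type) (d : T -> T -> R)
    (A : set T) (l : R) (g : R -> T) : unit_speed d A l g ->
  unit_speed d A l (fun t => g (l - t)).
Proof.
move=> [gA gd]; split=> [t /andP[? ?]|s t /andP[? ?] /andP[? ?]].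
  by apply: gA; lra.
rewrite gd; first by rewrite opprB addrC subrKA distrC.
  by lra.
by lra.
Qed.

Lemma CAT_geodesic (R : realType) (kappa r : R) (X : metricType R) (A : set X)
    (x y : X) : CAT_space kappa A -> cone_radius kappa r -> A x -> A y ->
  mdist x y <= 2 * r -> exists c, geodesic mdist A x y c.
Proof.
move=> [geo _] kr Ax Ay xy; apply: geo => //.
rewrite /model_diameter; case: ifPn => k0; last exact: ltry.
rewrite lte_fin ltr_pdivlMr ?sqrtr_gt0//.
have := kr k0; have := ler_wpM2r (sqrtr_ge0 kappa) xy; lra.
Qed.

(** The comparison points of the two points at fraction [t] are at most as far
    apart as the comparison vertices, whose distance is [mdist x y]. The case
    [x = y], where the two geodesics could differ a priori, is left out: it
    never arises when a single geodesic is chosen for each endpoint. *)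
Lemma cone_contraction (R : realType) (kappa r : R) (X : metricType R)
    (A : set X) (p x y : X) (cx cy : R -> X) :
  CAT_space kappa A -> cone_radius kappa r -> A x -> A y ->
  mdist p x <= r -> mdist p y <= r -> x != y ->
  geodesic mdist A p x cx -> geodesic mdist A p y cy ->
  forall t, 0 <= t <= 1 ->
    mdist (cx (t * mdist p x)) (cy (t * mdist p y)) <= mdist x y.
Proof.
move=> catA kr Ax Ay px py neq_xy gx gy t /andP[t0 t1].
(* If an endpoint is the apex, only one point moves, along a geodesic. *)
have degenerate (z w : X) (cz cw : R -> X) : p = z ->
    geodesic mdist A p z cz -> geodesic mdist A p w cw ->
    mdist (cz (t * mdist p z)) (cw (t * mdist p w)) <= mdist z w.
  move=> <- [cz0 _ _ _] [cw0 _ _ cwd]; rewrite mdistxx mulr0 cz0 -{1}cw0.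
  have d0 : 0 <= mdist p w by exact: mdist_ge0.
  rewrite cwd ?in_itv/= ?lexx ?d0 ?mulr_ge0 ?ler_piMl//.
  by rewrite sub0r normrN ger0_norm ?mulr_ge0// ler_piMl.
have [px0|px0] := eqVneq p x; first exact: degenerate.
have [py0|py0] := eqVneq p y.
  by rewrite metric_sym [leRHS]metric_sym; exact: degenerate.
have xy : mdist x y <= 2 * r.
  by rewrite (le_trans (metric_triangle x p y))// (metric_sym x); lra.
have [c1 g1] := CAT_geodesic catA kr Ax Ay xy.
have := geodesic_unit_speed gy => /unit_speed_rev cy'.
have := unit_speed_geodesic (mdist_ge0 _ _) cy'.
rewrite subrr subr0; case: (gy) => -> -> _ _ gy'.
have tri := geodesic_triangle_tri3 gx g1 gy'.
case: (catA) => _ /(_ _ _ tri) ineq.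
have perim :
    ((perimeter mdist (tri3 p x y))%:E < 2%:E * model_diameter kappa)%E.
  rewrite /model_diameter; case: ifPn => k0; last first.
    by rewrite mulry gtr0_sg// mul1e ltry.
  rewrite -EFinM lte_fin mulrA ltr_pdivlMr ?sqrtr_gt0//.
  rewrite /perimeter !big_ord_recl big_ord0 addr0 /tri3/= /bump/=.
  rewrite (metric_sym y p).
  have {}kr := kr k0; have s0 := sqrtr_ge0 kappa.
  have : mdist p x + (mdist x y + mdist p y) <= 4 * r by lra.
  by move/(ler_wpM2r s0); lra.
have {ineq} := ineq perim; rewrite /CAT_inequality.
have d0 (z w : X) : z != w -> 0 < mdist z w by rewrite mdist_gt0.
have tr1 := metric_triangle x p y.
have tr2 := metric_triangle p y x.
have tr3 := metric_triangle p x y.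
rewrite (metric_sym x p) in tr1; rewrite (metric_sym y x) in tr2.
have [g0 [h1 [h2 [[h02 h1a h1c] u0 u1 u2 hle]]]] :=
  model_comparison kr (d0 _ _ px0) (d0 _ _ py0) (d0 _ _ neq_xy)
    tr1 tr2 tr3 px py.
move=> /(_ (tri3 (g0 0) (g0 (mdist p x)) (h2 (mdist p y)))
  (tri3 g0 h1 (fun t => h2 (mdist p y - t)))).
have l0 (z w : X) : 0 <= mdist z w by exact: mdist_ge0.
have [d00 _] := unit_speed_dist (l0 _ _) u0.
have [d11 _] := unit_speed_dist (l0 _ _) u1.
have [_ d22] := unit_speed_dist (l0 _ _) u2.
have G2 := unit_speed_geodesic (l0 _ _) (unit_speed_rev u2).
have G0 := unit_speed_geodesic (l0 _ _) u0.
have G1 := unit_speed_geodesic (l0 _ _) u1.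
rewrite subr0 subrr -h02 in G2; rewrite h1a h1c in G1 d11.
rewrite -h02 in d22.
move=> /(_ _)/wrap[|].
  split; first exact: geodesic_triangle_tri3.
  case=> [[|[|[|//]]] ?]; rewrite /tri3/=; [exact: d00|exact: d11|].
  by rewrite (metric_sym y).
have t01 : 0 <= t <= 1 by rewrite t0.
pose i0 := Ordinal (isT : 0 < 3)%N; pose i2 := Ordinal (isT : 2 < 3)%N.
have ordS2 : ordS i2 = i0 by exact: val_inj.
have ordS0 : ordS i0 = Ordinal (isT : 1 < 3)%N by exact: val_inj.
move=> /(_ i0 i2 (t * mdist p x) (mdist p y - t * mdist p y)).
rewrite ordS2 ordS0 /tri3/= !subKr => H.
apply: le_trans (hle t t01); apply: H.
  by rewrite in_itv/= mulr_ge0//= ler_piMl.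
rewrite in_itv/= (metric_sym y p) subr_ge0 ler_piMl//= gerBl.
by rewrite mulr_ge0.
Qed.

(** * Square charts *)

Lemma heine_cantor (R : realType) (X Y : pseudoMetricType R) (K : set X)
    (f : X -> Y) : compact K ->
  (forall x, K x -> f @ nbhs x --> f x) ->
  forall e : R, 0 < e -> exists2 d : R, 0 < d &
    forall x y, K x -> K y -> ball x d y -> ball (f x) e (f y).
Proof.
move=> /compact_near_coveringP Kc fc e e0.
have near_d := Kc R (0^'+)
  (fun d x => K x -> forall y, ball x d y -> ball (f x) e (f y)) _ _.
have [|d /= d0 dP] := near_d.
  move=> x Kx; have e20 : 0 < e / 2 by rewrite divr_gt0.
  have /(_ _ (nbhsx_ballx _ _ e20)) := fc x Kx.
  rewrite /nbhs/= => /nbhs_ballP[d /= d0 dP].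
  have d20 : 0 < d / 2 by rewrite divr_gt0.
  exists (ball x (d / 2), [set t | t <= d / 2]); first split => /=.
  - exact: nbhsx_ballx.
  - exact: nbhs_right_le.
  move=> [x' t]/= [xx' td] _ y x'y; rewrite (splitr e).
  apply: (@ball_triangle _ _ (f x)).
    apply: ball_sym; apply: dP; apply: le_ball xx'.
    by rewrite ler_pdivrMr// ler_peMr ?ler1n// ltW.
  apply: dP; rewrite (splitr d); apply: ball_triangle xx' _.
  exact: le_ball x'y.
exists (d / 2); first by rewrite divr_gt0.
move=> x y Kx Ky xy; apply: (dP (d / 2)) => //=.
  by rewrite sub0r normrN gtr0_norm ?divr_gt0// ltr_pdivrMr// ltr_pMr// ltr1n.
by rewrite divr_gt0.
Qed.

Lemma ball_mdistE (R : realType) (X : metricType R) (x y : X) (e : R) :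
  ball x e y = (mdist x y < e).
Proof. by rewrite ballEmdist. Qed.

Lemma closed_metric_ball (R : realType) (X : metricType R) (p : X) (r : R) :
  closed (metric_ball p r).
Proof.
move=> z clz; rewrite /metric_ball/=; apply/ler_addgt0Pl => e e0.
have [w [/= pw]] := clz _ (nbhsx_ballx z e e0).
rewrite ball_mdistE metric_sym => wz.
by rewrite (le_trans (metric_triangle p w z))// addrC lerD// ltW.
Qed.

Definition vec2 (R : realType) (x y : R) : 'rV[R]_2 :=
  \row_(j < 2) [:: x; y]`_j.

(** A chart at [p] read in coordinates for which a square around [p] becomes
    [`[-1, 1] ^ 2]: [X], [Y] are the coordinates and [G] the parametrization.
    The radii are such that a segment of length at most [r / 2] issuing from a
    point of the square stays in the ball on which the coordinates are
    controlled. *)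
Record square_chart (R : realType) (Sigma : metricType R) (p : Sigma) (r : R)
    (X Y : Sigma -> R) (G : R -> R -> Sigma) : Prop := {
  sc_center : X p = 0 /\ Y p = 0 ;
  sc_ball : forall x y, `|x| <= 1 -> `|y| <= 1 -> mdist p (G x y) <= r / 2 ;
  sc_coord : forall x y, `|x| <= 1 -> `|y| <= 1 ->
    X (G x y) = x /\ Y (G x y) = y ;
  sc_param : forall a, mdist p a <= r -> G (X a) (Y a) = a ;
  sc_coord_unif : forall e, 0 < e -> exists2 d, 0 < d & forall a b,
    mdist p a <= r -> mdist p b <= r -> mdist a b < d ->
    `|X a - X b| < e /\ `|Y a - Y b| < e ;
  sc_param_unif : forall e, 0 < e -> exists2 d, 0 < d & forall x y x' y',
    `|x| <= 1 -> `|y| <= 1 -> `|x'| <= 1 -> `|y'| <= 1 ->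
    `|x - x'| < d -> `|y - y'| < d -> mdist (G x y) (G x' y') < e }.

Lemma ord2P (P : 'I_2 -> Prop) : P 0 -> P 1 -> forall i, P i.
Proof.
move=> P0 P1 [[|[|//]] i].
  by rewrite (_ : Ordinal _ = 0)//; exact: val_inj.
by rewrite (_ : Ordinal _ = 1)//; exact: val_inj.
Qed.

Lemma square_chart_exists (R : realType) (Sigma : metricType R) (p : Sigma)
    (r : R) : closed_surface R Sigma -> 0 < r ->
  exists r1 X Y G, [/\ 0 < r1, r1 <= r & @square_chart R Sigma p r1 X Y G].
Proof.
move=> [[_ _ euc] cmp _ _] r0.
have [U [V [f [g [oU Up oV [fUV fgK cf cg]]]]]] := euc p.
have {}cf x : U x -> f @ nbhs x --> f x.
  by move: cf; rewrite continuous_open_subspace// => + Ux; apply; rewrite inE.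
have {}cg v : V v -> g @ nbhs v --> g v.
  by move: cg; rewrite continuous_open_subspace// => + Vv; apply; rewrite inE.
have gfK x : U x -> g (f x) = x by move=> Ux; apply: fgK; rewrite inE.
have fV x : U x -> V (f x) by move=> Ux; rewrite -fUV; exists x.
have fgV v : V v -> f (g v) = v.
  by rewrite -fUV => -[u Uu <-]; rewrite gfK.
have /nbhs_ballP[e /= e0 eU] : nbhs p U by exact: open_nbhs_nbhs.
pose r1 := Num.min r (e / 2).
have r10 : 0 < r1 by rewrite lt_min r0 divr_gt0.
have BU : metric_ball p r1 `<=` U.
  move=> z /= pz; apply: eU; rewrite /= ball_mdistE (le_lt_trans pz)//.
  by rewrite gt_min ltr_pdivrMr// ltr_pMr// ltr1n orbT.
have Bc : compact (metric_ball p r1).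
  by apply: (subclosed_compact _ cmp) => //; exact: closed_metric_ball.
have r120 : 0 < r1 / 2 by rewrite divr_gt0.
have : \forall v \near f p, V v /\ mdist p (g v) < r1 / 2.
  apply: filterI; first exact: (open_nbhs_nbhs (conj oV (fV _ Up))).
  have := cg _ (fV _ Up); rewrite gfK// => /(_ _ (nbhsx_ballx p _ r120)).
  suff : ball p (r1 / 2) `<=` [set z | mdist p z < r1 / 2].
    by move=> sub; rewrite nbhs_simpl/=; apply: filterS => v; exact: sub.
  by move=> z /=; rewrite ball_mdistE.
move=> /nbhs_ballP[d /= d0 dP].
pose rho := d / 2.
have rho0 : 0 < rho by rewrite divr_gt0.
pose h x y := f p + rho *: vec2 x y.
have hE0 x y : h x y 0 0 = f p 0 0 + rho * x by rewrite /h !mxE.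
have hE1 x y : h x y 0 1 = f p 0 1 + rho * y by rewrite /h !mxE.
have hball x y : `|x| <= 1 -> `|y| <= 1 -> ball (f p) d (h x y).
  have rho_d : rho < d by rewrite /rho ltr_pdivrMr// ltr_pMr// ltr1n.
  have in_ball c t : `|t| <= 1 -> `|c - (c + rho * t)| < d.
    move=> t1; rewrite opprD addNKr normrN normrM (gtr0_norm rho0).
    by rewrite (le_lt_trans _ rho_d)// ler_piMr// ltW.
  move=> x1 y1; split=> // i; rewrite (ord1 i).
  by apply: ord2P; rewrite ?hE0 ?hE1 /ball/= in_ball.
pose X z := (f z 0 0 - f p 0 0) / rho.
pose Y z := (f z 0 1 - f p 0 1) / rho.
exists r1, X, Y, (fun x y => g (h x y)).
split=> //; first by rewrite ge_min lexx.
split.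
- by rewrite /X /Y !subrr !mul0r.
- by move=> x y x1 y1; have [_ /ltW] := dP _ (hball x y x1 y1).
- move=> x y x1 y1; have [Vh _] := dP _ (hball x y x1 y1).
  rewrite /X /Y fgV// hE0 hE1 !(addrC (f p _ _)) !addrK.
  by rewrite !(mulrC rho) !mulfK ?gt_eqF.
- move=> a /BU Ua; rewrite -[RHS](gfK _ Ua); congr g.
  apply/rowP; apply: ord2P; rewrite ?hE0 ?hE1 /X /Y mulrC divfK ?gt_eqF//.
    by rewrite subrKC.
  by rewrite subrKC.
- move=> e' e'0; have re0 : 0 < rho * e' by rewrite mulr_gt0.
  have [d' d'0 d'P] := heine_cantor Bc (fun x Bx => cf x (BU x Bx)) re0.
  exists d' => // a b pa pb; rewrite -ball_mdistE => /(d'P a b pa pb)[_ ab].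
  have := ab 0 0; have := ab 0 1; rewrite /ball/= /X /Y => h1 h2.
  rewrite -!mulrBl !normrM !normfV !(gtr0_norm rho0) !ltr_pdivrMr//.
  by rewrite !opprB !subrKA ![e' * _]mulrC.
- move=> e' e'0.
  pose K := [set v : 'rV[R]_2 | 
    forall i, `[f p 0 i - rho, f p 0 i + rho]%classic (v ord0 i)].
  have Kc : compact K.
    apply: (@rV_compact R 2
      (fun i => `[f p 0 i - rho, f p 0 i + rho]%classic)) => i.
    exact: segment_compact.
  have hK x y : `|x| <= 1 -> `|y| <= 1 -> K (h x y).
    rewrite !ler_norml => /andP[? ?] /andP[? ?] i.
    rewrite /= in_itv/=; move: i; apply: ord2P; rewrite ?hE0 ?hE1; nra.
  have KV v : K v -> V v.
    move=> Kv; suff : ball (f p) d v by move/dP => [].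
    split=> // i j; rewrite (ord1 i).
    have := Kv j; rewrite /= in_itv/= /ball/= => /andP[? ?].
    have dE : d = rho + rho by rewrite /rho -splitr.
    by rewrite ltr_norml; lra.
  have [d' d'0 d'P] := heine_cantor Kc (fun v Kv => cg v (KV v Kv)) e'0.
  exists (d' / rho); first by rewrite divr_gt0.
  move=> x y x' y' x1 y1 x'1 y'1 xx' yy'; rewrite -ball_mdistE.
  apply: d'P; [exact: hK|exact: hK|]; split => // i.
  rewrite (ord1 i); apply: ord2P; rewrite ?hE0 ?hE1 /ball/=.
    rewrite opprD addrACA subrr add0r -mulrBr normrM gtr0_norm// mulrC.
    by rewrite -ltr_pdivlMr.
  rewrite opprD addrACA subrr add0r -mulrBr normrM gtr0_norm// mulrC.
  by rewrite -ltr_pdivlMr.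
Qed.

(** * Fans of geodesic triangles fill a neighbourhood *)

Definition unit_itv (R : realType) (t : R) : Prop := 0 <= t <= 1.

Lemma unit_itv0 (R : realType) : unit_itv (0 : R).
Proof. by rewrite /unit_itv lexx ler01. Qed.

Lemma unit_itv_div (R : realType) (i n : nat) :
  (i <= n)%N -> unit_itv (i%:R / n%:R : R).
Proof.
move=> ilen; rewrite /unit_itv divr_ge0//=.
have [->|n0] := posnP n; first by rewrite invr0 mulr0.
by rewrite ler_pdivrMr ?ltr0n// mul1r ler_nat.
Qed.

Definition lipschitz_square (R : realType) (X : metricType R) (L : R)
    (h : R -> R -> X) : Prop :=
  forall s t s' t', unit_itv s -> unit_itv t -> unit_itv s' -> unit_itv t' ->
    mdist (h s t) (h s' t') <= L * (`|s - s'| + `|t - t'|).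

(** All that the construction of fans uses of the curvature bound. The choice
    of one geodesic per endpoint makes the contraction hold for [z = w] too. *)
Record cone_structure (R : realType) (X : metricType R) (p : X) (r : R)
    (cone : X -> R -> X) (seg : X -> X -> R -> X) : Prop := {
  cs_cone0 : forall z, mdist p z <= r -> cone z 0 = p ;
  cs_cone1 : forall z, mdist p z <= r -> cone z 1 = z ;
  cs_cone_dist : forall z s t, mdist p z <= r -> unit_itv s -> unit_itv t ->
    mdist (cone z s) (cone z t) = `|s - t| * mdist p z ;
  cs_cone_contr : forall z w t, mdist p z <= r -> mdist p w <= r ->
    unit_itv t -> mdist (cone z t) (cone w t) <= mdist z w ;
  cs_seg0 : forall z w, mdist p z <= r -> mdist p w <= r -> seg z w 0 = z ;
  cs_seg1 : forall z w, mdist p z <= r -> mdist p w <= r -> seg z w 1 = w ;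
  cs_seg_dist : forall z w s t, mdist p z <= r -> mdist p w <= r ->
    unit_itv s -> unit_itv t ->
    mdist (seg z w s) (seg z w t) = `|s - t| * mdist z w }.

Lemma geodesic_unit_interval (R : realType) (X : metricType R) (A : set X)
    (x y : X) (c : R -> X) : geodesic mdist A x y c ->
  [/\ c (0 * mdist x y) = x, c (1 * mdist x y) = y
    & forall s t, unit_itv s -> unit_itv t ->
       mdist (c (s * mdist x y)) (c (t * mdist x y)) = `|s - t| * mdist x y].
Proof.
move=> [c0 c1 _ cd]; rewrite mul0r mul1r.
split=> // s t /andP[s0 s1] /andP[t0 t1].
have d0 : 0 <= mdist x y by exact: mdist_ge0.
rewrite cd; last 2 first.
- by rewrite in_itv/= mulr_ge0// ler_piMl.
- by rewrite in_itv/= mulr_ge0// ler_piMl.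
by rewrite -mulrBl normrM (ger0_norm d0).
Qed.

Lemma CAT_cone_structure (R : realType) (kappa r r0 : R) (X : metricType R)
    (p : X) : CAT_space kappa (metric_ball p r) -> cone_radius kappa r0 ->
  0 <= r0 -> r0 <= r -> exists cone seg, cone_structure p r0 cone seg.
Proof.
move=> cat kr r00 r0r; set A := metric_ball p r.
have AE z : mdist p z <= r0 -> A z by move=> pz; exact: le_trans pz r0r.
have Ap : A p by apply: AE; rewrite mdistxx.
have [seg segP] : exists seg : X * X -> R -> X, forall zw,
    mdist p zw.1 <= r0 -> mdist p zw.2 <= r0 ->
    geodesic mdist A zw.1 zw.2 (seg zw).
  suff /choice[seg segP] : forall zw : X * X, exists c, mdist p zw.1 <= r0 ->
    mdist p zw.2 <= r0 -> geodesic mdist A zw.1 zw.2 c by exists seg.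
  move=> [z w]/=; have [pz|] := leP (mdist p z) r0; last by exists (fun=> z).
  have [pw|] := leP (mdist p w) r0; last by exists (fun=> z).
  have [|c cP] := CAT_geodesic cat kr (AE _ pz) (AE _ pw); last by exists c.
  by rewrite (le_trans (metric_triangle z p w))// (metric_sym z); lra.
have p0 : mdist p p <= r0 by rewrite mdistxx.
have coneP z : mdist p z <= r0 -> geodesic mdist A p z (seg (p, z)).
  by move=> pz; exact: (segP (p, z)).
exists (fun z t => seg (p, z) (t * mdist p z)).
exists (fun z w t => seg (z, w) (t * mdist z w)).
split.
- by move=> z /coneP/geodesic_unit_interval[].
- by move=> z /coneP/geodesic_unit_interval[].
- by move=> z s t /coneP/geodesic_unit_interval[_ _]; exact.
- move=> z w t pz pw t01; have [->|zw] := eqVneq z w.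
    by rewrite !mdistxx.
  exact: (cone_contraction cat kr (AE _ pz) (AE _ pw) pz pw zw (coneP _ pz)
    (coneP _ pw)).
- by move=> z w pz pw; have [] := geodesic_unit_interval (segP (z, w) pz pw).
- by move=> z w pz pw; have [] := geodesic_unit_interval (segP (z, w) pz pw).
- move=> z w s t pz pw.
  by have [_ _] := geodesic_unit_interval (segP (z, w) pz pw); exact.
Qed.

Section fan.
Context {R : realType} {X : metricType R} {p : X} {r : R}.
Context {cone : X -> R -> X} {seg : X -> X -> R -> X}.
Hypothesis cs : cone_structure p r cone seg.

Lemma cone_ball z t : mdist p z <= r -> unit_itv t -> mdist p (cone z t) <= r.
Proof.
move=> pz t01; rewrite -{1}(cs_cone0 cs pz) (cs_cone_dist cs)//;
  last exact: unit_itv0.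
case/andP: t01 => t0 t1; rewrite sub0r normrN ger0_norm//.
by rewrite (le_trans _ pz)// ler_piMl// mdist_ge0.
Qed.

Lemma seg_start z w t : mdist p z <= r -> mdist p w <= r -> unit_itv t ->
  mdist z (seg z w t) <= mdist z w.
Proof.
move=> pz pw t01; rewrite -{1}(cs_seg0 cs pz pw) (cs_seg_dist cs)//;
  last exact: unit_itv0.
case/andP: t01 => t0 t1; rewrite sub0r normrN ger0_norm//.
by rewrite ler_piMl// mdist_ge0.
Qed.

Lemma seg_ball z w t : 0 < r -> mdist p z <= r / 2 -> mdist p w <= r / 2 ->
  mdist z w <= r / 2 -> unit_itv t -> mdist p (seg z w t) <= r.
Proof.
move=> r0 pz pw zw t01; have := metric_triangle p z (seg z w t).
have : mdist z (seg z w t) <= mdist z w by apply: seg_start => //; lra.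
lra.
Qed.

Lemma fan_lipschitz z w : 0 < r -> mdist p z <= r / 2 -> mdist p w <= r / 2 ->
  mdist z w <= r / 2 -> lipschitz_square r (fun s t => cone (seg z w s) t).
Proof.
move=> r0 pz pw zw s t s' t' s01 t01 s'01 t'01.
have B u : unit_itv u -> mdist p (seg z w u) <= r by exact: seg_ball.
apply: le_trans (metric_triangle _ (cone (seg z w s) t') _) _.
rewrite mulrDr addrC lerD//.
  rewrite (le_trans (cs_cone_contr cs _ _ _))//; [exact: B|exact: B|].
  rewrite (cs_seg_dist cs)//; [|lra..].
  by rewrite mulrC ler_wpM2r//; lra.
by rewrite (cs_cone_dist cs) ?B// mulrC ler_wpM2r// B.
Qed.

(** The number modulo 2 of passages between the two lower quadrants along a
    curve, sampled at [M.+1] points. *)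
Definition sample_parity (lab : X -> bool * bool) (M : nat) (c : R -> X) :=
  split_parity M (fun i => lab (c (i%:R / M%:R))).

(** The parity count in the geodesic triangle with vertices [p], [z], [w],
    parametrized by the unit square. The side of the square that is collapsed
    to [p] contributes nothing. *)
Lemma fan_parity (x y : X -> R) (eta d : R) (M : nat) (z w : X) :
  0 < r -> mdist p z <= r / 2 -> mdist p w <= r / 2 -> mdist z w <= r / 2 ->
  (forall a b, mdist p a <= r -> mdist p b <= r -> mdist a b < d ->
    `|x a - x b| < eta /\ `|y a - y b| < eta) ->
  2 * r < d * M%:R ->
  (forall s t, unit_itv s -> unit_itv t ->
    ~ (`|x (cone (seg z w s) t)| < eta /\ `|y (cone (seg z w s) t)| < eta)) ->
  let lab a := quadrant (x a) (y a) in
  sample_parity lab M (seg z w) =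
  sample_parity lab M (cone z) (+) sample_parity lab M (cone w).
Proof.
move=> r0 pz pw zw unif rdM nohit lab.
have [pz' pw'] : mdist p z <= r /\ mdist p w <= r by split; lra.
have M0 : (0 < M)%N.
  by rewrite lt0n; apply/eqP => M0; move: rdM; rewrite M0 mulr0; lra.
have MR0 : 0 < M%:R :> R by rewrite ltr0n.
pose H i j := cone (seg z w (i%:R / M%:R)) (j%:R / M%:R).
have step i i' : (i <= i' <= i.+1)%N ->
    `|i%:R / M%:R - i'%:R / M%:R| <= M%:R^-1 :> R.
  move=> /andP[ii' i'i].
  rewrite -mulrBl normrM (gtr0_norm (_ : 0 < M%:R^-1)) ?invr_gt0//.
  rewrite ler_piMl ?invr_ge0 ?ler0n// distrC -natrB// normr_nat -[1]/(1%:R) ler_nat.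
  by rewrite leq_subLR addn1.
have := @split_parity_grid R M M eta
  (fun i j => x (H i j)) (fun i j => y (H i j)).
move=> /(_ _)/wrap[|].
  move=> i j i' j' ii' jj' i'M j'M.
  have [iM jM] : (i <= M)%N /\ (j <= M)%N.
    by move: ii' jj' => /andP[ii' _] /andP[jj' _];
      rewrite (leq_trans ii')// (leq_trans jj').
  apply: unif.
  - by apply: cone_ball; [apply: seg_ball|]; rewrite //; exact: unit_itv_div.
  - by apply: cone_ball; [apply: seg_ball|]; rewrite //; exact: unit_itv_div.
  apply: (@le_lt_trans _ _ (r * (M%:R^-1 + M%:R^-1))).
    apply: (le_trans (fan_lipschitz r0 pz pw zw (unit_itv_div R iM)
      (unit_itv_div R jM) (unit_itv_div R i'M) (unit_itv_div R j'M))).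
    by rewrite ler_wpM2l ?(ltW r0)// lerD// step.
  by rewrite (_ : r * _ = 2 * r / M%:R) ?ltr_pdivrMr//; ring.
move=> /(_ _)/wrap[|].
  by move=> i j iM jM; apply: nohit; exact: unit_itv_div.
rewrite /= => E.
have -> : sample_parity lab M (seg z w) =
    split_parity M (fun i => quadrant (x (H i M)) (y (H i M))).
  apply: eq_split_parity => i iM; rewrite /H divff ?gt_eqF// (cs_cone1 cs)//.
  by apply: seg_ball => //; exact: unit_itv_div.
have -> : sample_parity lab M (cone z) =
    split_parity M (fun j => quadrant (x (H 0%N j)) (y (H 0%N j))).
  by apply: eq_split_parity => j jM; rewrite /H mul0r (cs_seg0 cs).
have -> : sample_parity lab M (cone w) =
    split_parity M (fun j => quadrant (x (H M j)) (y (H M j))).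
  by apply: eq_split_parity => j jM; rewrite /H divff ?gt_eqF// (cs_seg1 cs).
rewrite -E [X in X (+) _](@split_parity_side (0 <= x p))// => i iM.
rewrite /H mul0r (cs_cone0 cs)//.
by apply: seg_ball => //; exact: unit_itv_div.
Qed.

End fan.

(** Suppose that the cones avoid a neighbourhood of [z]. By [fan_parity] the
    passages along an edge of the polygon are, modulo 2, the difference of the
    passages along the two rays from [p] to its endpoints. On the left, upper
    and right sides of the square no passage occurs, so the rays to the four
    corners have the same parity. But the lower side leads from one lower
    quadrant to the other, so the rays to its two ends have different
    parities. *)
Lemma square_fan_dense (R : realType) (Sigma : metricType R) (p : Sigma)
    (r : R) (X Y : Sigma -> R) (G : R -> R -> Sigma)
    (cone : Sigma -> R -> Sigma) (seg : Sigma -> Sigma -> R -> Sigma) :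
  0 < r -> square_chart p r X Y G -> cone_structure p r cone seg ->
  exists (I : finType) (h : I -> R -> R -> Sigma),
    (forall i, lipschitz_square r (h i)) /\
    forall z, mdist p z <= r -> `|X z| < 1 / 2 -> `|Y z| < 1 / 2 ->
      forall e, 0 < e -> exists i s t,
        [/\ unit_itv s, unit_itv t & mdist (h i s t) z < e].
Proof.
move=> r0 sc cs.
have half0 : 0 < 1 / 2 :> R by rewrite divr_gt0.
have [d1 d10 d1P] := sc_coord_unif sc half0.
have e10 : 0 < Num.min (r / 2) d1 by rewrite lt_min d10 divr_gt0.
have [d2 d20 d2P] := sc_param_unif sc e10.
(* [n] pieces per side, so that an edge stays within [1 / 2] of its vertices in
   each coordinate, hence on its own side of [z] *)
pose n := (Num.truncn (2 / d2)).+1.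
have n0 : 0 < n%:R :> R by rewrite ltr0n.
have nd2 : 2 / n%:R < d2.
  by rewrite ltr_pdivrMr// mulrC -ltr_pdivrMr// truncnS_gt.
pose u (k : nat) : R := 2 * (k%:R / n%:R) - 1.
have u1 k : (k <= n)%N -> `|u k| <= 1.
  by move=> /(unit_itv_div R)/andP[? ?]; rewrite ler_norml /u; lra.
have uS k : `|u k - u k.+1| < d2.
  have -> : u k - u k.+1 = - (2 / n%:R).
    by rewrite /u -[k.+1]addn1 natrD; field; rewrite gt_eqF.
  by rewrite normrN gtr0_norm ?divr_gt0.
have u0E : u 0%N = -1 by rewrite /u mul0r mulr0 sub0r.
have unE : u n = 1 by rewrite /u divff ?gt_eqF//; lra.
pose sgn (b : bool) : R := if b then 1 else -1.
(* The first boolean tells horizontal sides from vertical ones, the second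
   one is the sign of the fixed coordinate. *)
pose side (hb : bool * bool) k : Sigma :=
  if hb.1 then G (u k) (sgn hb.2) else G (sgn hb.2) (u k).
have sgn1 b : `|sgn b| <= 1 by case: b; rewrite /sgn ?normrN normr1.
have side_half hb k : (k <= n)%N -> mdist p (side hb k) <= r / 2.
  by move=> kn; rewrite /side; case: ifP => _; apply: (sc_ball sc); rewrite ?u1.
have side_ball hb k : (k <= n)%N -> mdist p (side hb k) <= r.
  move=> kn; rewrite (le_trans (side_half hb k kn))// ler_pdivrMr//.
  by rewrite ler_peMr ?ler1n// ltW.
have side_step hb k : (k < n)%N ->
    mdist (side hb k) (side hb k.+1) < Num.min (r / 2) d1.
  move=> kn; have kn' := ltnW kn.
  by rewrite /side; case: ifP => _; apply: d2P; rewrite ?u1 ?subrr ?normr0.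
exists ((bool * bool) * 'I_n)%type.
exists (fun (i : (bool * bool) * 'I_n) s t =>
  cone (seg (side i.1 i.2) (side i.1 i.2.+1) s) t).
have step_half hb k : (k < n)%N -> mdist (side hb k) (side hb k.+1) <= r / 2.
  by move=> /(side_step hb); rewrite lt_min => /andP[/ltW].
split.
  move=> [hb k]/=; apply: (fan_lipschitz cs r0).
  - by apply: side_half; exact: ltnW.
  - exact: side_half.
  - exact: step_half.
move=> z pz Xz Yz e e0; apply: contrapT => nohit.
have [d3 d30 d3P] := sc_param_unif sc e0.
pose eta := Num.min d3 (1 / 2).
have eta0 : 0 < eta by rewrite lt_min d30.
pose x a := X a - X z; pose y a := Y a - Y z.
have [d4 d40 d4P] : exists2 d, 0 < d & forall a b, mdist p a <= r ->
    mdist p b <= r -> mdist a b < d -> `|x a - x b| < eta /\ `|y a - y b| < eta.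
  have [d d0 dP] := sc_coord_unif sc eta0.
  by exists d => // a b pa pb /(dP _ _ pa pb); rewrite /x /y !opprB !subrKA.
pose M := (Num.truncn (2 * r / d4)).+1.
have Md4 : 2 * r < d4 * M%:R.
  by rewrite (mulrC d4) -ltr_pdivrMr// truncnS_gt.
pose lab a := quadrant (x a) (y a).
have fan hb k : (k < n)%N ->
    sample_parity lab M (seg (side hb k) (side hb k.+1)) =
    sample_parity lab M (cone (side hb k)) (+)
    sample_parity lab M (cone (side hb k.+1)).
  move=> kn; apply: (fan_parity cs r0 _ _ _ d4P Md4).
  - by apply: side_half; exact: ltnW.
  - exact: side_half.
  - exact: step_half.
  move=> s t s01 t01; set a := cone _ _ => -[xa ya]; apply: nohit.
  exists (hb, Ordinal kn), s, t; split=> //=; rewrite -/a.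
  have pa : mdist p a <= r.
    apply: (cone_ball cs) => //; apply: (seg_ball cs r0) => //.
    - by apply: side_half; exact: ltnW.
    - exact: side_half.
    - exact: step_half.
  rewrite -(sc_param sc pa) -(sc_param sc pz).
  move: xa ya Xz Yz; rewrite /x /y /eta !lt_min => /andP[xa xa2] /andP[ya ya2].
  move=> Xz Yz; apply: d3P => //.
  + by move: xa2 Xz; rewrite !ltr_norml ler_norml => /andP[? ?] /andP[? ?]; lra.
  + by move: ya2 Yz; rewrite !ltr_norml ler_norml => /andP[? ?] /andP[? ?]; lra.
  + by move: Xz; rewrite !ltr_norml ler_norml => /andP[? ?]; lra.
  + by move: Yz; rewrite !ltr_norml ler_norml => /andP[? ?]; lra.
have seg_near hb k s : (k < n)%N -> unit_itv s ->
    `|X (seg (side hb k) (side hb k.+1) s) - X (side hb k)| < 1 / 2 /\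
    `|Y (seg (side hb k) (side hb k.+1) s) - Y (side hb k)| < 1 / 2.
  move=> kn s01; have kn' := ltnW kn.
  have := side_step hb k kn; rewrite lt_min => /andP[st1 st2].
  have B1 := side_half hb k kn'; have B2 := side_half hb k.+1 kn.
  apply: d1P.
  - by apply: (seg_ball cs r0) => //; exact: ltW.
  - exact: side_ball.
  - rewrite metric_sym (le_lt_trans _ st2)//.
    by apply: (seg_start cs) => //; exact: side_ball.
pose V a := sample_parity lab M (cone a).
have telescope hb (b : nat -> bool) :
    (forall k, (k < n)%N ->
      V (side hb k) (+) V (side hb k.+1) = b k (+) b k.+1) ->
    V (side hb 0%N) (+) V (side hb n) = b 0%N (+) b n.
  move=> H; suff: forall k, (k <= n)%N ->
      V (side hb 0%N) (+) V (side hb k) = b 0%N (+) b k by apply.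
  elim=> [|k IHk] kn; first by rewrite !addbb.
  have := IHk (ltnW kn); have := H k kn.
  by do 3!case: (V _); case: (b 0%N); case: (b k); case: (b k.+1).
have coord hb k : (k <= n)%N ->
    X (side hb k) = (if hb.1 then u k else sgn hb.2) /\
    Y (side hb k) = (if hb.1 then sgn hb.2 else u k).
  by move=> kn; rewrite /side; case: ifP => _; apply: (sc_coord sc); rewrite ?u1.
move: Xz Yz; rewrite !ltr_norml => /andP[Xz1 Xz2] /andP[Yz1 Yz2].
have vert b : V (side (false, b) 0%N) = V (side (false, b) n).
  suff : V (side (false, b) 0%N) (+) V (side (false, b) n) = false.
    by case: (V _); case: (V _).
  rewrite (telescope _ xpred0)// => k kn; rewrite -fan//.
  apply: (@split_parity_side b) => i iM.
  have [+ _] := seg_near (false, b) k _ kn (unit_itv_div R iM).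
  have [-> _] := coord (false, b) k (ltnW kn).
  rewrite /lab /= /x /sgn ltr_norml => /andP[h1 h2].
  by case: b h1 h2 => h1 h2; [apply/idP; lra|apply/negbTE; rewrite -ltNge; lra].
have top : V (side (true, true) 0%N) = V (side (true, true) n).
  suff : V (side (true, true) 0%N) (+) V (side (true, true) n) = false.
    by case: (V _); case: (V _).
  rewrite (telescope _ xpred0)// => k kn; rewrite -fan//.
  apply: split_parity_upper => i iM.
  have [_ +] := seg_near (true, true) k _ kn (unit_itv_div R iM).
  have [_ ->] := coord (true, true) k (ltnW kn).
  by rewrite /lab /= /y /sgn ltr_norml => /andP[h1 h2]; lra.
have bottom : V (side (true, false) 0%N) (+) V (side (true, false) n) = true.
  rewrite (telescope _ (fun k => 0 <= x (side (true, false) k))); last first.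
    move=> k kn; rewrite -fan//.
    have B1 := side_ball (true, false) k (ltnW kn).
    have B2 := side_ball (true, false) k.+1 kn.
    have M0 : M%:R != 0 :> R by rewrite gt_eqF// ltr0n.
    rewrite /sample_parity split_parity_lower.
      by rewrite mul0r divff// (cs_seg0 cs) ?(cs_seg1 cs).
    move=> i iM.
    have [_ +] := seg_near (true, false) k _ kn (unit_itv_div R iM).
    have [_ ->] := coord (true, false) k (ltnW kn).
    by rewrite /lab /= /y /sgn ltr_norml -ltNge => /andP[h1 h2]; lra.
  have [X0 _] := coord (true, false) 0%N (leq0n n).
  have [X1 _] := coord (true, false) n (leqnn n).
  rewrite /x X0 X1 /= u0E unE.
  rewrite (_ : (0 <= -1 - X z) = false); last by apply/negbTE; rewrite -ltNge; lra.
  by rewrite (_ : (0 <= 1 - X z) = true)//; apply/idP; lra.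
have cBL : side (false, false) 0%N = side (true, false) 0%N.
  by rewrite /side/= u0E.
have cTL : side (false, false) n = side (true, true) 0%N.
  by rewrite /side/= u0E unE.
have cBR : side (false, true) 0%N = side (true, false) n.
  by rewrite /side/= u0E unE.
have cTR : side (false, true) n = side (true, true) n.
  by rewrite /side/= unE.
by move: bottom; rewrite -cBL -cBR !vert cTL cTR top addbb.
Qed.

(** * Quadratic covering numbers *)

(** Compactness is applied to the filter generated by the sets of all
    supersets of [A], for [A] with property [P]. *)
Lemma compact_local_global (T : topologicalType) (P : set T -> Prop) :
  compact [set: T] -> P set0 ->
  (forall A B, P A -> P B -> P (A `|` B)) ->
  (forall A B, A `<=` B -> P B -> P A) ->
  (forall x : T, exists2 A, nbhs x A & P A) -> P setT.
Proof.
move=> /compact_near_coveringP cT P0 PU Psub Pnbhs.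
have FF : Filter (filter_from P (fun A => [set B | A `<=` B])).
  apply: filter_from_filter; first by exists set0.
  move=> A B PA PB; exists (A `|` B); first exact: PU.
  by move=> C /=; rewrite subUset.
have [|A PA /(_ A (@subset_refl _ _)) TA] := cT _ _ (fun B x => B x) FF.
  move=> x _; have [A Ax PA] := Pnbhs x.
  exists (A, [set B | A `<=` B]); first by split => //=; exists A.
  by move=> [y B]/= [Ay AB]; exact: AB.
exact: Psub TA PA.
Qed.

(** Finite two-dimensional upper Minkowski content, in the form of a bound on
    covering numbers. *)
Definition quad_covered (R : realType) (X : metricType R) (A : set X) : Prop :=
  exists2 C : R, 0 <= C & forall m : nat, (0 < m)%N ->
    exists2 s : seq X, (size s)%:R <= C * m%:R ^+ 2 &
      forall x, A x -> exists2 c, c \in s & mdist c x <= m%:R^-1.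

Section quad_covered_theory.
Context {R : realType} {X : metricType R}.
Implicit Types A B : set X.

Lemma quad_covered0 : quad_covered (set0 : set X).
Proof. by exists 0 => // m _; exists nil => //=; rewrite mul0r. Qed.

Lemma quad_coveredU A B :
  quad_covered A -> quad_covered B -> quad_covered (A `|` B).
Proof.
move=> [C C0 HA] [D D0 HB]; exists (C + D) => [|m m0]; first exact: addr_ge0.
have [s sC sA] := HA m m0; have [t tD tB] := HB m m0.
exists (s ++ t); first by rewrite size_cat natrD mulrDl lerD.
by move=> x [/sA|/tB] [c cs cx]; exists c => //; rewrite mem_cat cs ?orbT.
Qed.

Lemma sub_quad_covered A B : A `<=` B -> quad_covered B -> quad_covered A.
Proof.
move=> AB [C C0 HB]; exists C => // m /HB[s sC sB]; exists s => // x /AB.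
exact: sB.
Qed.

Lemma grid_approx (N : nat) (s : R) : (0 < N)%N -> unit_itv s ->
  exists2 a, (a <= N)%N & `|s - a%:R / N%:R| <= N%:R^-1.
Proof.
move=> N0 /andP[s0 s1]; have NR0 : 0 < N%:R :> R by rewrite ltr0n.
have sN0 : 0 <= s * N%:R by rewrite mulr_ge0// ltW.
have /andP[a1 a2] := truncn_itv sN0.
exists (Num.truncn (s * N%:R)).
  rewrite -(ler_nat R) (le_trans a1)// ler_piMl// ltW.
rewrite -{1}[s](mulfK (lt0r_neq0 NR0)) -mulrBl normrM.
rewrite (gtr0_norm (_ : 0 < N%:R^-1)) ?invr_gt0//.
rewrite ler_piMl ?invr_ge0 ?(ltW NR0)// ger0_norm ?subr_ge0//.
by rewrite lerBlDl ltW// natr1.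
Qed.

(** A grid of mesh proportional to [1 / m] in each square has about [m ^ 2]
    points; density of the images is enough because radius [1 / m] leaves room
    for it. *)
Lemma quad_covered_lipschitz (I : finType) (h : I -> R -> R -> X) (L : R) A :
  (forall i, lipschitz_square L (h i)) ->
  (forall x, A x -> forall e, 0 < e -> exists i s t,
     [/\ unit_itv s, unit_itv t & mdist (h i s t) x < e]) ->
  quad_covered A.
Proof.
move=> hL dense.
(* mesh [1 / (K * m)], which the maps send to distances at most [1 / (2 * m)] *)
pose K := (Num.truncn (4 * `|L|)).+1.
have K4 : 4 * `|L| <= K%:R by apply: ltW; rewrite truncnS_gt.
exists (#|I|%:R * (2 * K%:R) ^+ 2) => [|m m0].
  by rewrite mulr_ge0// exprn_ge0// mulr_ge0.
pose N := (K * m)%N.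
have N0 : (0 < N)%N by rewrite muln_gt0.
have NR0 : 0 < N%:R :> R by rewrite ltr0n.
have mR0 : 0 < m%:R :> R by rewrite ltr0n.
pose pts := [seq h i (ab.1%:R / N%:R) (ab.2%:R / N%:R) |
  i <- enum I, ab <- [seq (a, b) | a <- iota 0 N.+1, b <- iota 0 N.+1]].
exists pts.
  rewrite !size_allpairs !size_iota -cardE natrM -mulrA ler_wpM2l//.
  rewrite -exprMn -[(_ * m%:R) in leRHS]mulrA -natrM -/N natrM -expr2.
  rewrite ler_sqr ?nnegrE ?mulr_ge0// ?ler0n// -natrM ler_nat mul2n -addnn.
  by rewrite -addn1 leq_add2l.
move=> x Ax; have e0 : 0 < (2 * m%:R)^-1 :> R by rewrite invr_gt0 mulr_gt0.
have [i [s [t [s01 t01 hx]]]] := dense x Ax _ e0.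
have [a aN sa] := grid_approx N0 s01; have [b bN tb] := grid_approx N0 t01.
exists (h i (a%:R / N%:R) (b%:R / N%:R)).
  apply/allpairsPdep; exists i, (a, b); split => //; first by rewrite mem_enum.
  by apply/allpairsPdep; exists a, b; split => //; rewrite mem_iota/= add0n ltnS.
apply: le_trans (metric_triangle _ (h i s t) _) _.
rewrite (_ : m%:R^-1 = (2 * m%:R)^-1 + (2 * m%:R)^-1); last first.
  by field; rewrite gt_eqF.
apply: lerD; last exact: ltW.
rewrite metric_sym; apply: le_trans (hL i _ _ _ _ s01 t01 (unit_itv_div R aN)
  (unit_itv_div R bN)) _.
have h1 : L * (`|s - a%:R / N%:R| + `|t - b%:R / N%:R|) <=
    `|L| * (N%:R^-1 + N%:R^-1).
  apply: (le_trans (ler_norm _)).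
  rewrite normrM ler_wpM2l// ger0_norm ?addr_ge0//.
  exact: lerD.
apply: le_trans h1 _.
rewrite (_ : _ * _ = 2 * `|L| / N%:R); last ring.
rewrite ler_pdivrMr// (mulrC _^-1) ler_pdivlMr ?mulr_gt0// natrM.
rewrite (_ : _ * (2 * _) = 4 * `|L| * m%:R); last ring.
by rewrite ler_wpM2r.
Qed.

End quad_covered_theory.

Lemma quad_covered_surface (R : realType) (kappa : R) (Sigma : metricType R) :
  closed_surface R Sigma -> locally_CAT kappa Sigma ->
  quad_covered [set: Sigma].
Proof.
move=> surf [_ cat]; have [_ cmp _ _] := surf.
apply: compact_local_global => //.
- exact: quad_covered0.
- exact: quad_coveredU.
- exact: sub_quad_covered.
move=> p; have [r r0 catp] := cat p.
(* adding 1 to the square root makes the bound meaningful for all [kappa] *)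
pose r0' := Num.min r (pi / 2 / (Num.sqrt kappa + 1)).
have sk0 : 0 < Num.sqrt kappa + 1 by rewrite ltr_wpDl ?sqrtr_ge0.
have r0'0 : 0 < r0' by rewrite lt_min r0 !divr_gt0// pi_gt0.
have [r1 [X [Y [G [r10 r1r sc]]]]] := square_chart_exists p surf r0'0.
have r1r' : r1 <= r by rewrite (le_trans r1r)// ge_min lexx.
have kr : cone_radius kappa r1.
  move=> k0; have : r1 * (Num.sqrt kappa + 1) <= pi / 2.
    by rewrite -ler_pdivlMr// (le_trans r1r)// ge_min lexx orbT.
  by rewrite mulrDr mulr1; lra.
have [cone [seg cs]] := CAT_cone_structure catp kr (ltW r10) r1r'.
have [I [h [hL dense]]] := square_fan_dense r10 sc cs.
have half0 : 0 < 1 / 2 :> R by rewrite divr_gt0.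
have [d d0 dP] := sc_coord_unif sc half0.
exists (metric_ball p r1 `&` ball p d).
  apply: filterI; last exact: nbhsx_ballx.
  apply/nbhs_ballP; exists r1 => //= z; rewrite ball_mdistE.
  exact: ltW.
apply: (quad_covered_lipschitz hL) => z [/= pz]; rewrite ball_mdistE => pz' e e0.
have [X0 Y0] := sc_center sc.
have pp : mdist p p <= r1 by rewrite mdistxx ltW.
have [] := dP p z pp pz pz'; rewrite X0 Y0 !sub0r !normrN => Xz Yz.
exact: dense.
Qed.

(** * Upper bounds for Hausdorff measures *)

Section hausdorff_upper.
Context {R : realType} {X : metricType R}.
Implicit Types (A : set X) (s eps : R).
Local Open Scope ereal_scope.

Lemma hausdorff_gauge_ge0 s A : 0 <= hausdorff_gauge s A.
Proof. by rewrite /hausdorff_gauge; case: ifP => // _; exact: poweR_ge0. Qed.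

Lemma hausdorff_content_ge0 s eps A : 0 <= hausdorff_content s eps A.
Proof.
apply/ereal_infP => _ [U _ <-].
by apply: nneseries_ge0 => n _ _; exact: hausdorff_gauge_ge0.
Qed.

Lemma mdiam_ge0 A : A !=set0 -> 0 <= mdiam A.
Proof.
move=> [x Ax]; apply: ereal_sup_ubound; exists (x, x) => //=.
by rewrite mdistxx.
Qed.

Lemma le_mdiam A d : (forall x y, A x -> A y -> (mdist x y <= d)%R) ->
  mdiam A <= d%:E.
Proof.
by move=> H; apply/ereal_supP => _ [[x y] [/= Ax Ay] <-]; rewrite lee_fin H.
Qed.

Lemma hausdorff_gauge_le s A (d : R) : (0 <= s)%R -> (0 <= d)%R ->
  mdiam A <= d%:E -> hausdorff_gauge s A <= (d `^ s)%:E.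
Proof.
move=> s0 d0 Ad; rewrite /hausdorff_gauge; case: ifP => [_|/negbT A0].
  by rewrite lee_fin powR_ge0.
rewrite -poweR_EFin; apply: gt0_ler_poweR => //.
- by rewrite in_itv/= leey andbT mdiam_ge0//; apply/set0P.
- by rewrite in_itv/= leey andbT lee_fin.
Qed.

Lemma hausdorff_content_le_size s eps A (c : seq X) (rho : R) :
  (0 <= s)%R -> (0 <= rho)%R -> (2 * rho <= eps)%R ->
  (forall x, A x -> exists2 y, y \in c & (mdist y x <= rho)%R) ->
  hausdorff_content s eps A <= ((size c)%:R * (2 * rho) `^ s)%:E.
Proof.
move=> s0 rho0 rhoe cov.
pose U i := [set x | exists2 y, onth c i = Some y & (mdist y x <= rho)%R].
have UD i : mdiam (U i) <= (2 * rho)%:E.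
  apply: le_mdiam => x y [z cz zx] [w cw wy].
  have zw : z = w by move: cz; rewrite cw => -[].
  rewrite -zw in wy; rewrite (le_trans (metric_triangle x z y))//.
  by rewrite (metric_sym x z); lra.
apply: (@le_trans _ _ (\sum_(0 <= i <oo) hausdorff_gauge s (U i))).
  apply: ereal_inf_lbound; exists U => //; split; last first.
    by move=> i; rewrite (le_trans (UD i))// lee_fin.
  move=> x /cov[y /onthP[i ci] yx]; exists i => //; by exists y.
rewrite (nneseries_split 0 (size c));
  last by move=> k _; exact: hausdorff_gauge_ge0.
rewrite [X in _ + X]eseries0 ?adde0; last first.
  move=> i; rewrite add0n => ci _; rewrite /hausdorff_gauge ifT//; apply/eqP.
  by rewrite -subset0 => x [y]; rewrite onth_default.
rewrite add0n big_mkord mulr_natl.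
apply: (@le_trans _ _ (\sum_(i < size c) ((2 * rho) `^ s)%:E)).
  by apply: lee_sum => i _; apply: hausdorff_gauge_le => //; rewrite mulr_ge0.
by rewrite sumEFin sumr_const card_ord.
Qed.

Lemma quad_covered_measure2 A : quad_covered A -> hausdorff_measure 2 A < +oo.
Proof.
move=> [C C0 HC]; apply: (@le_lt_trans _ _ (C * 4)%:E); last exact: ltry.
apply/ereal_supP => _ [eps /= eps0 <-].
pose m := (Num.truncn (2 / eps)).+1.
have m0 : (0 < m%:R :> R)%R by rewrite ltr0n.
have [//|c sc cA] := HC m.
have mle : (2 / m%:R <= eps)%R.
  by rewrite ler_pdivrMr// mulrC -ler_pdivrMr// ltW// truncnS_gt.
have mV0 : (0 <= m%:R^-1 :> R)%R by rewrite invr_ge0 ltW.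
apply: le_trans (hausdorff_content_le_size (ler0n R 2) mV0 mle cA) _.
rewrite lee_fin (powR_mulrn 2) ?mulr_ge0// ?invr_ge0 ?(ltW m0)//.
have -> : (C * 4 = C * m%:R ^+ 2 * (2 / m%:R) ^+ 2)%R.
  by field; rewrite gt_eqF.
by rewrite ler_wpM2r// exprn_ge0// mulr_ge0.
Qed.

(** The sum of the diameters to the power [s] is at most [4 * C * (2 / m) `^
    (s - 2)]. *)
Lemma quad_covered_measure0 s A : (2 < s)%R -> quad_covered A ->
  hausdorff_measure s A = 0.
Proof.
move=> s2 [C C0 HC]; apply/eqP; rewrite eq_le; apply/andP; split; last first.
  apply: (le_trans (hausdorff_content_ge0 s 1 A)).
  by apply: ereal_sup_ubound; exists 1%R => //=; exact: ltr01.
apply/ereal_supP => _ [eps /= eps0 <-].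
apply/lee_addgt0Pr => e e0; rewrite add0e.
have s20 : (0 < s - 2)%R by rewrite subr_gt0.
have D0 : (0 < C * 4 + 1)%R by rewrite ltr_wpDl// mulr_ge0.
pose t := ((e / (C * 4 + 1)) `^ (s - 2)^-1)%R.
have t0 : (0 < t)%R by rewrite powR_gt0// divr_gt0.
pose m := (Num.truncn (2 / Num.min eps t)).+1.
have m0 : (0 < m%:R :> R)%R by rewrite ltr0n.
have [//|c sc cA] := HC m.
have mle : (2 / m%:R <= Num.min eps t)%R.
  rewrite ler_pdivrMr// mulrC -ler_pdivrMr ?lt_min ?eps0//.
  by rewrite ltW// truncnS_gt.
have mle1 : (2 / m%:R <= eps)%R by rewrite (le_trans mle)// ge_min lexx.
have mle2 : (2 / m%:R <= t)%R by rewrite (le_trans mle)// ge_min lexx orbT.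
have m20 : (0 < 2 / m%:R :> R)%R by rewrite divr_gt0.
have mV0 : (0 <= m%:R^-1 :> R)%R by rewrite invr_ge0 ltW.
have s0 : (0 <= s)%R by rewrite (le_trans _ (ltW s2)).
apply: le_trans (hausdorff_content_le_size s0 mV0 mle1 cA) _.
rewrite lee_fin (_ : s = 2 + (s - 2))%R; last ring.
rewrite powRD; last by rewrite (gt_eqF m20) implybT.
rewrite (powR_mulrn 2) ?(ltW m20)// mulrA.
have h1 : ((2 / m%:R) `^ (s - 2) <= e / (C * 4 + 1))%R.
  rewrite (_ : e / _ = t `^ (s - 2))%R; last first.
    by rewrite -powRrM mulVf ?gt_eqF// powRr1// divr_ge0// ltW.
  by apply: ge0_ler_powR => //; rewrite ?nnegrE ltW.
have h2 : ((size c)%:R * (2 / m%:R) ^+ 2 <= C * 4)%R.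
  have -> : (C * 4 = C * m%:R ^+ 2 * (2 / m%:R) ^+ 2)%R.
    by field; rewrite gt_eqF.
  by rewrite ler_wpM2r// exprn_ge0// ltW.
apply: (@le_trans _ _ (C * 4 * (e / (C * 4 + 1)))%R).
  by apply: ler_pM => //; exact: powR_ge0.
by rewrite mulrCA ler_piMr ?(ltW e0)// ler_pdivrMr// mul1r lerDl.
Qed.

End hausdorff_upper.

(** * The Poincare-Miranda theorem and the Besicovitch inequality *)

(** The parity count on a fine grid yields approximate zeros: the only split
    edges on the boundary are on the lower side, and their number is odd.
    Compactness of the square turns approximate zeros into a zero. *)
Lemma poincare_miranda (R : realType) (f g : R -> R -> R) :
  (forall e, 0 < e -> exists2 d, 0 < d & forall x y x' y',
    `|x| <= 1 -> `|y| <= 1 -> `|x'| <= 1 -> `|y'| <= 1 ->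
    `|x - x'| < d -> `|y - y'| < d ->
    `|f x y - f x' y'| < e /\ `|g x y - g x' y'| < e) ->
  (forall y, `|y| <= 1 -> f (-1) y < 0 < f 1 y) ->
  (forall x, `|x| <= 1 -> g x (-1) < 0 < g x 1) ->
  exists x y, [/\ `|x| <= 1, `|y| <= 1, f x y = 0 & g x y = 0].
Proof.
move=> unif f01 g01.
have approx eta : 0 < eta -> exists x y,
    [/\ `|x| <= 1, `|y| <= 1, `|f x y| < eta & `|g x y| < eta].
  move=> eta0; apply: contrapT => nohit.
  have [d d0 dP] := unif eta eta0.
  pose M := (Num.truncn (2 / d)).+1.
  have MR0 : 0 < M%:R :> R by rewrite ltr0n.
  have Md : 2 / M%:R < d by rewrite ltr_pdivrMr// mulrC -ltr_pdivrMr// truncnS_gt.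
  pose u (k : nat) : R := 2 * (k%:R / M%:R) - 1.
  have u1 k : (k <= M)%N -> `|u k| <= 1.
    by move=> /(unit_itv_div R)/andP[? ?]; rewrite ler_norml /u; lra.
  have u0E : u 0%N = -1 by rewrite /u mul0r mulr0 sub0r.
  have uME : u M = 1 by rewrite /u divff ?gt_eqF//; lra.
  have step k k' : (k <= k' <= k.+1)%N -> `|u k - u k'| < d.
    move=> /andP[kk' k'k]; apply: le_lt_trans Md.
    rewrite (_ : u k - u k' = (2 / M%:R) * (k%:R - k'%:R)); last first.
      by rewrite /u; field; rewrite gt_eqF.
    rewrite normrM gtr0_norm ?divr_gt0// ler_piMr ?divr_ge0//.
    rewrite distrC -natrB// normr_nat -[1]/(1%:R) ler_nat.
    by rewrite leq_subLR addn1.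
  have := @split_parity_grid R M M eta (fun i j => f (u i) (u j))
    (fun i j => g (u i) (u j)).
  move=> /(_ _)/wrap[|].
    move=> i j i' j' ii' jj' i'M j'M.
    have [iM jM] : (i <= M)%N /\ (j <= M)%N.
      by move: ii' jj' => /andP[ii' _] /andP[jj' _];
        rewrite (leq_trans ii')// (leq_trans jj').
    by apply: dP; rewrite ?u1//; exact: step.
  move=> /(_ _)/wrap[|].
    move=> i j iM jM [fe ge]; apply: nohit.
    by exists (u i), (u j); split; rewrite ?u1.
  rewrite /= split_parity_lower; last first.
    by move=> i iM; rewrite /= -ltNge u0E; have /andP[] := g01 _ (u1 i iM).
  rewrite [X in _ (+) X]split_parity_upper; last first.
    by move=> i iM; rewrite /= uME; have /andP[_ /ltW] := g01 _ (u1 i iM).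
  rewrite [X in _ = X (+) _](@split_parity_side false); last first.
    move=> i iM; apply/negbTE; rewrite /= -ltNge u0E.
    by have /andP[] := f01 _ (u1 i iM).
  rewrite [X in _ = _ (+) X](@split_parity_side true); last first.
    move=> i iM; rewrite /= uME; apply/idP.
    by have /andP[_ /ltW] := f01 _ (u1 i iM).
  have u1' : `|u 0%N| <= 1 by exact: u1.
  have /andP[fneg fpos] := f01 _ u1'; move: fneg fpos.
  by rewrite /= u0E uME => fneg fpos; rewrite leNgt fneg (ltW fpos).
pose K := (`[-1, 1] `*` `[-1, 1] : set (R * R)).
have Kc : compact K by apply: compact_setX; exact: segment_compact.
have KE x y : K (x, y) <-> `|x| <= 1 /\ `|y| <= 1.
  by rewrite /K /= !in_itv/= !ler_norml; split => [[]|[]].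
apply: contrapT => nozero.
pose h (z : R * R) := `|f z.1 z.2| + `|g z.1 z.2|.
have hpos z : K z -> 0 < h z.
  case: z => x y /KE[x1 y1]; rewrite lt_neqAle addr_ge0// andbT eq_sym.
  rewrite paddr_eq0// !normr_eq0; apply/negP => /andP[/eqP fz /eqP gz].
  by apply: nozero; exists x, y.
move/compact_near_coveringP/near_covering_withinP : Kc => Kc.
have [|e /= e0 eP] := Kc R (0^'+) (fun e z => e < h z) _.
  move=> z Kz; have h40 : 0 < h z / 4 by rewrite divr_gt0// hpos.
  have [d d0 dP] := unif _ h40.
  exists (ball z d, [set t | t <= h z / 4]); first split => /=.
  - exact: nbhsx_ballx.
  - exact: nbhs_right_le.
  case: z Kz h40 dP => x y /KE[x1 y1] h40 dP.
  move=> [[x' y'] t]/= [[/= xx' yy'] te] /KE[x'1 y'1].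
  have [] := dP x y x' y' x1 y1 x'1 y'1 xx' yy'.
  have := ler_normD (f x y - f x' y') (f x' y').
  have := ler_normD (g x y - g x' y') (g x' y').
  rewrite !subrK; move: te h40; rewrite /h/=; lra.
have e20 : 0 < e / 2 by rewrite divr_gt0.
have e2b : ball_ Num.norm 0 e (e / 2).
  by rewrite /ball_/= sub0r normrN gtr0_norm// ltr_pdivrMr// ltr_pMr// ltr1n.
have e40 : 0 < e / 2 / 2 by rewrite divr_gt0.
have [x [y [x1 y1 fe ge]]] := approx _ e40.
have Kxy : K (x, y) by exact/KE.
have := eP (e / 2) e2b e20 (x, y) Kxy.
by rewrite /h /=; lra.
Qed.

Definition inf_dist (R : realType) (X : metricType R) (A : set X) (x : X) : R :=
  inf [set mdist a x | a in A].

Section inf_dist_theory.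
Context {R : realType} {X : metricType R}.
Implicit Types (A : set X) (x y : X).

Lemma inf_dist_le A a x : A a -> inf_dist A x <= mdist a x.
Proof.
move=> Aa; apply: ge_inf; last by exists a.
by exists 0 => _ [b _ <-]; exact: mdist_ge0.
Qed.

Lemma inf_dist_ge A x w : A !=set0 -> (forall a, A a -> w <= mdist a x) ->
  w <= inf_dist A x.
Proof.
move=> [a Aa] H; apply: lb_le_inf; first by exists (mdist a x), a.
by move=> _ [b Ab <-]; exact: H.
Qed.

Lemma inf_dist0 A x : A x -> inf_dist A x = 0.
Proof.
move=> Ax; apply/eqP; rewrite eq_le -{1}(mdistxx x) inf_dist_le//=.
by apply: inf_dist_ge => [|a _]; [exists x|exact: mdist_ge0].
Qed.

Lemma inf_dist_lipschitz A x y : A !=set0 ->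
  `|inf_dist A x - inf_dist A y| <= mdist x y.
Proof.
move=> A0; rewrite ler_norml; apply/andP; split.
  rewrite lerBrDl; apply: inf_dist_ge => // a Aa.
  rewrite lerBlDr (le_trans (inf_dist_le y Aa))//.
  exact: metric_triangle.
rewrite lerBlDr; rewrite -lerBlDl; apply: inf_dist_ge => // a Aa.
rewrite lerBlDl (le_trans (inf_dist_le x Aa))// metric_sym.
by rewrite (le_trans (metric_triangle x y a))// (metric_sym a y).
Qed.

End inf_dist_theory.

(** The distances [F1], [F2] to the left and lower sides are 1-Lipschitz,
    vanish on these sides and are at least [w] on the opposite ones. By
    [poincare_miranda] the open square of side [w] is in the image of [(F1,
    F2)]. The image of [U i] lies in a square of side twice the diameter of [U
    i], whence the factor 4. *)
Lemma besicovitch_inequality (R : realType) (X : metricType R) (w : R)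
    (G : R -> R -> X) (U : (set X)^nat) (eps : R) :
  0 < w ->
  (forall e, 0 < e -> exists2 d, 0 < d & forall x y x' y',
    `|x| <= 1 -> `|y| <= 1 -> `|x'| <= 1 -> `|y'| <= 1 ->
    `|x - x'| < d -> `|y - y'| < d -> mdist (G x y) (G x' y') < e) ->
  (forall y y', `|y| <= 1 -> `|y'| <= 1 -> w <= mdist (G (-1) y) (G 1 y')) ->
  (forall x x', `|x| <= 1 -> `|x'| <= 1 -> w <= mdist (G x (-1)) (G x' 1)) ->
  (forall x y, `|x| <= 1 -> `|y| <= 1 -> (\bigcup_i U i) (G x y)) ->
  (forall i, (mdiam (U i) <= eps%:E)%E) ->
  ((w ^+ 2)%:E <= 4%:E * \sum_(0 <= i <oo) hausdorff_gauge 2 (U i))%E.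
Proof.
move=> w0 unif hL hB cov Ueps.
pose left := [set G (-1) y | y in [set y | `|y| <= 1]].
pose bot := [set G x (-1) | x in [set x | `|x| <= 1]].
have left0 : left !=set0 by exists (G (-1) 0), 0; rewrite /= ?normr0.
have bot0 : bot !=set0 by exists (G 0 (-1)), 0; rewrite /= ?normr0.
pose F1 := inf_dist left; pose F2 := inf_dist bot.
have surj q1 q2 : 0 < q1 < w -> 0 < q2 < w -> exists x y,
    [/\ `|x| <= 1, `|y| <= 1, F1 (G x y) = q1 & F2 (G x y) = q2].
  move=> /andP[q10 q1w] /andP[q20 q2w].
  have [|||x [y [x1 y1 /eqP f0 /eqP g0]]] := @poincare_miranda R
    (fun x y => F1 (G x y) - q1) (fun x y => F2 (G x y) - q2).
  - move=> e /unif[d d0 dP]; exists d => // x y x' y' x1 y1 x'1 y'1 xx' yy'.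
    rewrite !opprB !subrKA; have := dP x y x' y' x1 y1 x'1 y'1 xx' yy'.
    by split; exact: (le_lt_trans (inf_dist_lipschitz _ _ _)).
  - move=> y y1; rewrite /F1 inf_dist0; last by exists y.
    rewrite sub0r oppr_lt0 q10 subr_gt0 (lt_le_trans q1w)//.
    by apply: inf_dist_ge => // _ [y' y'1 <-]; exact: hL.
  - move=> x x1; rewrite /F2 inf_dist0; last by exists x.
    rewrite sub0r oppr_lt0 q20 subr_gt0 (lt_le_trans q2w)//.
    by apply: inf_dist_ge => // _ [x' x'1 <-]; exact: hB.
  by exists x, y; split=> //; apply/eqP; rewrite -subr_eq0.
pose dm i := fine (mdiam (U i)).
have dmE i : U i !=set0 -> mdiam (U i) = (dm i)%:E.
  move=> Ui; rewrite /dm fineK// ge0_fin_numE ?mdiam_ge0//.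
  exact: le_lt_trans (Ueps i) (ltry _).
have dmP i a b : U i a -> U i b -> mdist a b <= dm i.
  move=> Ua Ub; rewrite -lee_fin -dmE; last by exists a.
  by apply: ereal_sup_ubound; exists (a, b).
pose mu := (@lebesgue_measure R \x @lebesgue_measure R)%E.
have /choice[D DP] : forall i, exists Di : set (R * R),
    [/\ measurable Di, (forall a, U i a -> Di (F1 a, F2 a)) &
    (mu Di <= 4%:E * hausdorff_gauge 2 (U i))%E].
  move=> i; have [U0|/eqP/set0P Ui] := pselect (U i = set0).
    exists set0; split => //; first by rewrite U0.
    by rewrite /mu measure0 mule_ge0// hausdorff_gauge_ge0.
  have [z Uz] := Ui.
  have dm0 : 0 <= dm i by rewrite -lee_fin -dmE// mdiam_ge0.
  pose J c := `[c - dm i, c + dm i]%classic.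
  exists (J (F1 z) `*` J (F2 z)); split.
  - by apply: measurableX; exact: measurable_itv.
  - move=> a Ua; have za := dmP _ _ _ Ua Uz.
    have J_mem (A : set X) : A !=set0 -> J (inf_dist A z) (inf_dist A a).
      move=> A0; have := le_trans (inf_dist_lipschitz a z A0) za.
      by rewrite /J/= in_itv/= ler_norml => /andP[? ?]; apply/andP; split; lra.
    by split; exact: J_mem.
  - rewrite /mu product_measure1E; [|exact: measurable_itv..].
    have JE c : (lebesgue_measure (J c) <= (2 * dm i)%:E)%E.
      rewrite lebesgue_measure_itv/=; case: ifPn => _.
        by rewrite -EFinB lee_fin; lra.
      by rewrite lee_fin mulr_ge0.
    apply: (@le_trans _ _ ((2 * dm i)%:E * (2 * dm i)%:E)%E).
      by apply: lee_pmul; do ?[exact: JE|exact: measure_ge0].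
    rewrite /hausdorff_gauge ifF; last by apply/negbTE/set0P.
    rewrite dmE// poweR_EFin powR_mulrn// -!EFinM lee_fin.
    by rewrite le_eqVlt; apply/orP; left; apply/eqP; ring.
pose I0 : set R := `]0, w[%classic.
have IE : lebesgue_measure I0 = w%:E.
  by rewrite lebesgue_measure_itv/= lte_fin w0 oppr0 adde0.
pose S := I0 `*` I0.
have muS : mu S = (w ^+ 2)%:E.
  rewrite /mu product_measure1E; [|exact: measurable_itv..].
  by rewrite [X in (X * X)%E]IE -EFinM expr2.
rewrite -nneseriesZl; last by move=> i _; exact: hausdorff_gauge_ge0.
rewrite -muS.
apply: (@le_trans _ _ (\sum_(0 <= i <oo) mu (D i))%E).
  apply: measure_sigma_subadditive.
  - by move=> i; have [] := DP i.
  - by apply: measurableX; exact: measurable_itv.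
  move=> [q1 q2] [/=]; rewrite /I0/= !in_itv/= => q1w q2w.
  have [x [y [x1 y1 <- <-]]] := surj q1 q2 q1w q2w.
  have [i _ Ui] := cov x y x1 y1; exists i => //.
  by have [_ H _] := DP i; exact: H.
by apply: lee_nneseries => i _ //; have [] := DP i.
Qed.

Lemma square_chart_gauge (R : realType) (Sigma : metricType R) (p : Sigma)
    (r : R) (X Y : Sigma -> R) (G : R -> R -> Sigma) :
  0 < r -> square_chart p r X Y G ->
  exists2 c : R, 0 < c & forall (U : (set Sigma)^nat) (eps : R),
    metric_ball p r `<=` \bigcup_i U i ->
    (forall i, (mdiam (U i) <= eps%:E)%E) ->
    (c%:E <= \sum_(0 <= i <oo) hausdorff_gauge 2 (U i))%E.
Proof.
move=> r0 sc; have [w w0 wP] := sc_coord_unif sc ltr01.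
have n1 : `|-1| <= 1 :> R by rewrite normrN normr1.
have p1 : `|1| <= 1 :> R by rewrite normr1.
have GB x y : `|x| <= 1 -> `|y| <= 1 -> mdist p (G x y) <= r.
  by move=> x1 y1; rewrite (le_trans (sc_ball sc x1 y1))// ler_pdivrMr//; lra.
exists (w ^+ 2 / 4); first by rewrite divr_gt0// exprn_gt0.
move=> U eps cov Ueps.
have sep x y x' y' : `|x| <= 1 -> `|y| <= 1 -> `|x'| <= 1 -> `|y'| <= 1 ->
    1 <= `|x - x'| \/ 1 <= `|y - y'| -> w <= mdist (G x y) (G x' y').
  move=> x1 y1 x'1 y'1 far; rewrite leNgt; apply/negP => near.
  have [] := wP _ _ (GB x y x1 y1) (GB x' y' x'1 y'1) near.
  have [-> ->] := sc_coord sc x1 y1; have [-> ->] := sc_coord sc x'1 y'1.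
  by case: far; lra.
have d2 : 1 <= `|-1 - 1| :> R by rewrite -opprD normrN ger0_norm; lra.
rewrite mulrC EFinM lee_pdivrMl//.
apply: (besicovitch_inequality w0 (sc_param_unif sc) _ _ _ Ueps).
- by move=> y y' y1 y'1; apply: sep => //; left.
- by move=> x x' x1 x'1; apply: sep => //; right.
- by move=> x y x1 y1; apply: cov; exact: GB.
Qed.

(** * Area and dimension of locally CAT surfaces *)

(** The bound of [square_chart_gauge] at [p] for the radius [delta / 2] serves
    for all centres [q] within [delta / 2] of [p]. *)
Lemma surface_ball_gauge (R : realType) (Sigma : metricType R) (delta : R) :
  closed_surface R Sigma -> 0 < delta ->
  exists2 c : R, 0 < c & forall q (U : (set Sigma)^nat) (eps : R),
    metric_ball q delta `<=` \bigcup_i U i ->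
    (forall i, (mdiam (U i) <= eps%:E)%E) ->
    (c%:E <= \sum_(0 <= i <oo) hausdorff_gauge 2 (U i))%E.
Proof.
move=> surf delta0; have [_ cmp _ _] := surf.
pose P (A : set Sigma) := exists2 c : R, 0 < c &
  forall q, A q -> forall (U : (set Sigma)^nat) (eps : R),
    metric_ball q delta `<=` \bigcup_i U i ->
    (forall i, (mdiam (U i) <= eps%:E)%E) ->
    (c%:E <= \sum_(0 <= i <oo) hausdorff_gauge 2 (U i))%E.
suff : P setT by move=> [c c0 H]; exists c => // q; exact: H.
apply: compact_local_global => //.
- by exists 1.
- move=> A B [a a0 HA] [b b0 HB]; exists (Num.min a b).
    by rewrite lt_min a0.
  move=> q [Aq|Bq] U eps cov Ue.
    by apply: (le_trans _ (HA q Aq U eps cov Ue)); rewrite lee_fin ge_min lexx.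
  by apply: (le_trans _ (HB q Bq U eps cov Ue)); rewrite lee_fin ge_min lexx orbT.
- by move=> A B AB [b b0 HB]; exists b => // q /AB; exact: HB.
move=> p; have delta20 : 0 < delta / 2 by rewrite divr_gt0.
have [r [X [Y [G [r0 rd sc]]]]] := square_chart_exists p surf delta20.
have [c c0 cP] := square_chart_gauge r0 sc.
exists (ball p (delta / 2)); first exact: nbhsx_ballx.
exists c => // q; rewrite ball_mdistE => pq U eps cov; apply: cP.
move=> z; rewrite /metric_ball/= => pz; apply: cov; rewrite /metric_ball/=.
by rewrite (le_trans (metric_triangle q p z))// (metric_sym q p); lra.
Qed.

Lemma hausdorff_measure_subset (R : realType) (X : metricType R) (s : R)
    (A B : set X) : A `<=` B ->
  (hausdorff_measure s A <= hausdorff_measure s B)%E.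
Proof.
move=> AB; apply/ereal_supP => _ [eps eps0 <-].
apply: (@le_trans _ _ (hausdorff_content s eps B)).
  apply/ereal_infP => _ [U [cov Ue] <-]; apply: ereal_inf_lbound.
  by exists U => //; split => //; exact: subset_trans cov.
by apply: ereal_sup_ubound; exists eps.
Qed.

Lemma hausdorff_gauge_anti (R : realType) (X : metricType R) (A : set X)
    (s t : R) : 0 <= s <= t -> (mdiam A <= 1)%E ->
  (hausdorff_gauge t A <= hausdorff_gauge s A)%E.
Proof.
move=> /andP[s0 st] A1; rewrite /hausdorff_gauge; case: ifPn => // /set0P A0.
have dA0 := mdiam_ge0 A0.
have : mdiam A \is a fin_num by rewrite ge0_fin_numE// (le_lt_trans A1)// ltry.
move: A1 dA0; case: (mdiam A) => // d; rewrite !lee_fin => d1 d0 _.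
have [->|dn0] := eqVneq d 0.
  rewrite /powR eqxx ler_nat; have [t0|//] := eqVneq t 0.
  by rewrite (_ : s = 0) ?eqxx//; apply/eqP; rewrite eq_le s0 -t0 st.
by rewrite ger_powR// lt_neqAle eq_sym dn0 d0.
Qed.

(** If some measure of dimension [s < 2] vanished, there would be covers by
    sets of diameter at most 1 with an arbitrarily small sum of diameters to
    the power [s], hence with a smaller sum of squared diameters, against
    [surface_ball_gauge]. *)
Lemma surface_hausdorff_dim (R : realType) (kappa : R) (Sigma : metricType R) :
  closed_surface R Sigma -> locally_CAT kappa Sigma ->
  hausdorff_dim [set: Sigma] = 2%:E.
Proof.
move=> surf cat; have quad := quad_covered_surface surf cat.
have [c c0 cP] := surface_ball_gauge surf ltr01.
have [_ _ _ [p _]] := surf.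
apply/eqP; rewrite eq_le; apply/andP; split.
  apply/lee_addgt0Pr => e e0; apply: ereal_inf_lbound.
  exists (2 + e) => //; split; first by rewrite addr_ge0// ltW.
  by apply: quad_covered_measure0 => //; rewrite ltrDl.
apply/ereal_infP => _ [s [s0 Hs] <-]; rewrite lee_fin leNgt; apply/negP => s2.
have : (hausdorff_content s 1 [set: Sigma] < c%:E)%E.
  rewrite (@le_lt_trans _ _ 0%E)// -Hs; apply: ereal_sup_ubound.
  by exists 1 => //=; exact: ltr01.
move=> /ereal_inf_lt[_ [U [cov U1] <-]]; apply/negP; rewrite -leNgt.
apply: (le_trans (cP p U 1 _ U1)); first by move=> z _; exact: cov.
apply: lee_nneseries => [i _ _|i _]; first exact: hausdorff_gauge_ge0.
by apply: hausdorff_gauge_anti => //; rewrite s0 ltW.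
Qed.

Theorem theorem1 (R : realType) (kappa : R) (Sigma : metricType R)
    (hSigma : closed_surface R Sigma) (hd : locally_CAT kappa Sigma) :
  hausdorff_dim [set: Sigma] = 2%:E /\
  exists2 delta0 : R, 0 < delta0 &
    forall delta : R, 0 < delta -> delta <= delta0 ->
      (0 < ereal_inf [set hausdorff_measure 2 (metric_ball p delta) |
                       p in [set: Sigma]])%E /\
      (ereal_sup [set hausdorff_measure 2 (metric_ball p delta) |
                   p in [set: Sigma]] < +oo)%E.
Proof.
split; first exact: surface_hausdorff_dim hd.
exists 1 => // delta delta0 _; split.
- have [c c0 cP] := surface_ball_gauge hSigma delta0.
  apply: (@lt_le_trans _ _ c%:E) => //.
  apply/ereal_infP => _ [q _ <-].
  apply: (@le_trans _ _ (hausdorff_content 2 1 (metric_ball q delta))).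
    by apply/ereal_infP => _ [U [cov U1] <-]; exact: cP cov U1.
  by apply: ereal_sup_ubound; exists 1 => //=; exact: ltr01.
- have quad := quad_covered_surface hSigma hd.
  apply: le_lt_trans (quad_covered_measure2 quad).
  apply/ereal_supP => _ [q _ <-]; apply: hausdorff_measure_subset.
  exact: subsetT.
Qed.
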